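(* Assume the Orthogonal Vectors Hypothesis (OVH). Let $\ell \geq 1$ and $q\ge 0$ be integers. Then, in the RAM model, there is no algorithm distinguishing between graphs of diameter $2\ell + q$ and graphs of diameter $3\ell + q$ in time $O\bigl(m^{2-\delta}/(\ell+q)^{2-\delta}\bigr)$ for any constant $\delta > 0$, where $m$ is the number of edges of the graph.
   Context: Graphs are unweighted and undirected. An algorithm distinguishes between graphs of diameter $a$ and graphs of diameter $b$ if, given a graph promised to have diameter either $a$ or $b$, it decides which of the two cases holds. An orthogonal vectors instance consists of two sets $L=\{l_1,\dots,l_n\}$ and $R=\{r_1,\dots,r_n\}$ of $d$-dimensional bit vectors; it contains an orthogonal pair if there are $l_i\in L$ and $r_j\in R$ such that for every $1\le k\le d$, $l_i[k]=0$ or $r_j[k]=0$. Orthogonal Vectors Hypothesis (OVH): in the RAM model there is no algorithm that decides whether a given orthogonal vectors instance (with $n$ vectors in each set, of dimension $d$) contains an orthogonal pair in time $O(n^{2-\delta}\operatorname{poly}(d))$ for some constant $\delta>0$. *)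

(* Defs.v *)
From mathcomp Require Import all_boot all_order all_algebra.
From mathcomp Require Import reals exp.

Set Implicit Arguments.
Unset Strict Implicit.
Unset Printing Implicit Defensive.

Import Order.TTheory GRing.Theory Num.Theory.

(** * Word RAM

    A program has finitely many registers (those it mentions) and a random
    access memory that is reached by indirect addressing.  Every instruction
    has unit cost.  Words have w bits: an instruction whose result does not fit
    in w bits crashes the machine, so no number larger than a word is ever
    manipulated. *)

Inductive binop := Add | Sub | Mul | Div | Mod | And | Or | Xor | Shl | Shr.

(* [Sub] is truncated, so that [x <= y] is tested by [x - y = 0]. *)
Definition eval_binop (o : binop) : nat -> nat -> nat :=
  match o with
  | Add => addn   | Sub => subn   | Mul => muln
  | Div => divn   | Mod => modn
  | And => Nat.land | Or => Nat.lor | Xor => Nat.lxor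
  | Shl => Nat.shiftl | Shr => Nat.shiftr
  end.

Inductive instr :=
| Const (r c : nat)                 (* r := c *)
| Op (o : binop) (r r1 r2 : nat)    (* r := r1 o r2 *)
| Read (r ra : nat)                 (* r := mem[ra] *)
| Write (ra r : nat)                (* mem[ra] := r *)
| Jump (target : nat)
| JumpZ (r target : nat)            (* jump if r = 0 *)
| Halt.

Definition program := seq instr.

Record state := State { pc : nat; reg : nat -> nat; mem : nat -> nat }.

Definition upd (f : nat -> nat) (i v : nat) : nat -> nat :=
  fun j => if j == i then v else f j.

Definition set_reg (w : nat) (s : state) (r v : nat) : option state :=
  if v < 2 ^ w then Some (State (pc s).+1 (upd (reg s) r v) (mem s)) else None.

(* [None] is a crash.  [Halt] idles, so that a machine which has halted after t
   steps is still halted after any larger number of steps. *)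
Definition step (w : nat) (P : program) (s : state) : option state :=
  match onth P (pc s) with
  | None => None
  | Some i =>
    match i with
    | Const r c => set_reg w s r c
    | Op o r r1 r2 => set_reg w s r (eval_binop o (reg s r1) (reg s r2))
    | Read r ra => set_reg w s r (mem s (reg s ra))
    | Write ra r =>
        Some (State (pc s).+1 (reg s) (upd (mem s) (reg s ra) (reg s r)))
    | Jump t => Some (State t (reg s) (mem s))
    | JumpZ r t =>
        Some (State (if reg s r == 0 then t else (pc s).+1) (reg s) (mem s))
    | Halt => Some s
    end
  end.

Definition exec (w : nat) (P : program) (t : nat) (s : state) : option state :=
  iter t (obind (step w P)) (Some s).

Definition init (inp : seq nat) : state := State 0 (fun=> 0) (nth 0 inp).

(* Words of O(log N) bits, where N accounts for the number of input words and
   for the largest of them; the constant [k] is chosen by the algorithm. *)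
Definition word_size (k : nat) (inp : seq nat) : nat :=
  k * up_log 2 (2 + size inp + \max_(x <- inp) x).

(* Within t steps, P halts on input [inp] with answer [ans] in register 0. *)
Definition outputs (P : program) (k : nat) (inp : seq nat) (t : nat)
    (ans : bool) : Prop :=
  exists s : state,
    [/\ exec (word_size k inp) P t (init inp) = Some s,
        onth P (pc s) = Some Halt
      & (reg s 0 != 0) = ans].

(** * Orthogonal vectors *)

Definition has_orthogonal_pair (n d : nat) (L R : n.-tuple (d.-tuple bool)) :
    bool :=
  [exists i : 'I_n, exists j : 'I_n, forall k : 'I_d,
     (tnth (tnth L i) k == false) || (tnth (tnth R j) k == false)].

(* n, d, then the entries of l_1, ..., l_n, r_1, ..., r_n, one bit per word. *)
Definition ov_input (n d : nat) (L R : n.-tuple (d.-tuple bool)) : seq nat :=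
  [:: n, d & [seq nat_of_bool b | b <- flatten (map val (L ++ R))]].

Local Open Scope ring_scope.

(* The constant of the O(.) is absorbed by the polynomial p. *)
Definition OVH (R : realType) : Prop :=
  ~ exists (P : program) (k : nat) (delta : R) (p : {poly R}),
      0 < delta /\
      forall (n d : nat) (L R' : n.-tuple (d.-tuple bool)), (0 < n)%N ->
        exists t : nat,
          outputs P k (ov_input L R') t (has_orthogonal_pair L R') /\
          t%:R <= n%:R `^ (2 - delta) * p.[d%:R].

(** * Graphs on the vertex set {0, ..., n-1} and their diameter *)

Definition simple_graph (n : nat) (e : rel 'I_n) : Prop :=
  symmetric e /\ irreflexive e.

Definition edges (n : nat) (e : rel 'I_n) : {set {set 'I_n}} :=
  [set [set p.1; p.2] | p : 'I_n * 'I_n & e p.1 p.2].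

Definition walk (n : nat) (e : rel 'I_n) (u v : 'I_n) (k : nat) : Prop :=
  exists p : seq 'I_n, [/\ path e u p, last u p = v & size p = k].

Definition is_dist (n : nat) (e : rel 'I_n) (u v : 'I_n) (k : nat) : Prop :=
  walk e u v k /\ forall j : nat, walk e u v j -> (k <= j)%N.

(* The largest distance is D; in particular all distances are finite. *)
Definition has_diameter (n : nat) (e : rel 'I_n) (D : nat) : Prop :=
  (forall u v : 'I_n, exists2 k : nat, (k <= D)%N & is_dist e u v k) /\
  (exists u v : 'I_n, is_dist e u v D).

(* [s] lists every edge exactly once, in any order and orientation. *)
Definition edge_list (n : nat) (e : rel 'I_n) (s : seq ('I_n * 'I_n)) : Prop :=
  perm_eq [seq [set p.1; p.2] | p <- s] (enum (edges e)).

(* n, m, then the end points of the m edges. *)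
Definition graph_input (n : nat) (s : seq ('I_n * 'I_n)) : seq nat :=
  [:: n, size s & flatten [seq [:: val p.1; val p.2] | p <- s]].

(* Some algorithm distinguishes diameter a from diameter b in time O(T(m)).
   Nothing is required of it on graphs that violate the promise. *)
Definition distinguishable_in_time (R : realType) (a b : nat) (T : nat -> R) :
    Prop :=
  exists (P : program) (k : nat) (C : R),
    forall (n : nat) (e : rel 'I_n) (s : seq ('I_n * 'I_n)),
      simple_graph e -> edge_list e s ->
      has_diameter e a \/ has_diameter e b ->
      exists (t : nat) (ans : bool),
        [/\ outputs P k (graph_input s) t ans,
            if ans then has_diameter e a else has_diameter e b
          & t%:R <= C * T #|edges e|].

(* Main.v *)
(** With a = floor(l/2) and b = ceil(l/2), an orthogonal vectors instance is
    turned into a graph as follows.  Every vector is a centre; two further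
    centres, one hub per side, play the role of all-ones vectors.  Every
    coordinate k is a path of length q whose ends face the two sides, and centres
    with bit 1 in k are joined to the end on their side by a path of length b.
    Every centre carries a pendant path of length a, and the tip of the hub's
    pendant path is the apex of its side: the other centres are at distance b from
    it, and the two apices are joined by a path of length l + q.

    All vertices of a side are within a of a centre and within l of the apex.
    Through the apices, all distances are at most 3l + q, and at most 2l + q
    unless the end points are on opposite sides.  If no pair is orthogonal, any
    two centres of opposite sides share a coordinate, which gives
    a + (b + q + b) + a = 2l + q.  A 1-Lipschitz potential shows that the pendant
    tips of an orthogonal pair are at distance 3l + q, because every detour
    through another centre or the apices costs at least l.

    The graph has O(n(d + 1)) edges, and a word RAM lists them in linear time by a
    single loop with a straight-line body.  It then simulates the distinguishing
    algorithm on the listed graph, which lies behind the input in memory.  Since l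
    and q are fixed, the factor (l + q)^(2 - delta) is a constant; replacing delta
    by min(delta, 1) makes the linear preprocessing affordable. *)

Require Import Defs.
From mathcomp Require Import all_boot all_order all_algebra.
From mathcomp Require Import reals exp.
From mathcomp Require Import zify ring lra.
From Stdlib Require PeanoNat Classical_Prop.

(** * Distances and edge lists *)

Section Distances.
Set Implicit Arguments.
Unset Strict Implicit.
Variables (N : nat) (e : rel 'I_N).
Hypothesis e_sym : symmetric e.

Definition dist_le (u v : 'I_N) (k : nat) : Prop :=
  exists2 j, j <= k & walk e u v j.

Lemma dist_leW u v j k : j <= k -> dist_le u v j -> dist_le u v k.
Proof. by move=> jk [i ij W]; exists i => //; apply: leq_trans jk. Qed.

Lemma dist_le0 u : dist_le u u 0.
Proof. by exists 0 => //; exists [::]. Qed.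

Lemma dist_le1 u v : e u v -> dist_le u v 1.
Proof. by move=> uv; exists 1 => //; exists [:: v]; rewrite /= uv. Qed.

Lemma dist_le_trans v u w j k :
  dist_le u v j -> dist_le v w k -> dist_le u w (j + k).
Proof.
move=> [j' jj' [p [pp pv ps]]] [k' kk' [r [rp rw rs]]].
exists (j' + k'); first exact: leq_add.
exists (p ++ r); split; last by rewrite size_cat ps rs.
- by rewrite cat_path pp pv.
- by rewrite last_cat pv.
Qed.

Lemma dist_le_sym u v k : dist_le u v k -> dist_le v u k.
Proof.
move=> [j jk [p [pp pv ps]]]; exists j => //; exists (rev (belast u p)); split.
- rewrite -pv rev_path; apply: sub_path pp => x y /=.
  by rewrite e_sym.
- by case: p pp pv ps => [|x p] //= _ <- _; rewrite rev_cons last_rcons.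
- by rewrite size_rev size_belast.
Qed.

(** Strong induction on the length; [walk] is a proposition, so whether a shorter walk exists is
    settled by excluded middle. *)
Lemma is_dist_exists u v k :
  dist_le u v k -> exists2 j, j <= k & is_dist e u v j.
Proof.
elim/ltn_ind: k => k IH [j jk W].
case: (Classical_Prop.classic (exists2 i, i < j & walk e u v i)) => [[i ij Wi]|H].
  have [|i' ii' D] := IH i (leq_trans ij jk); first by exists i.
  by exists i' => //; apply: leq_trans ii' (leq_trans (ltnW ij) jk).
exists j => //; split=> // i Wi; rewrite leqNgt; apply/negP => ij.
by apply: H; exists i.
Qed.

(** The source of all lower bounds on distances: instead of analysing walks, one exhibits a function
    and reads off its increase. *)
Lemma walk_potential (f : 'I_N -> nat) u v k :
  (forall x y, e x y -> f y <= (f x).+1) -> walk e u v k -> f v <= f u + k.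
Proof.
move=> Hf [p [pp <- <-]] {v k}.
elim: p u pp => [|x p IH] u /=; first by rewrite addn0.
move=> /andP[/Hf H /IH]; lia.
Qed.

Lemma has_diameterI D u v :
  (forall x y, dist_le x y D) -> (forall k, walk e u v k -> D <= k) ->
  has_diameter e D.
Proof.
move=> UB LB; split=> [x y|]; first exact: is_dist_exists (UB x y).
exists u, v; have [j jD W] := UB u v; split=> //.
by have <- : j = D by apply/eqP; rewrite eqn_leq jD LB.
Qed.

(** Makes the answer of a distinguishing algorithm unambiguous once the two diameters differ. *)
Lemma has_diameter_inj D D' : has_diameter e D -> has_diameter e D' -> D = D'.
Proof.
suff le D1 D2 : has_diameter e D1 -> has_diameter e D2 -> D1 <= D2.
  by move=> H H'; apply/eqP; rewrite eqn_leq !le.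
move=> [_ [u [v [_ min]]]] [/(_ u v)[k kD [W _]] _].
exact: leq_trans (min _ W) kD.
Qed.

End Distances.

(** * Graphs given by a list of increasing pairs *)

Section EdgeList.
Variables (N : nat) (s : seq ('I_N * 'I_N)).

Definition graph_of : rel 'I_N := fun u v => ((u, v) \in s) || ((v, u) \in s).

Hypothesis s_lt : forall p, p \in s -> p.1 < p.2.
Hypothesis s_uniq : uniq s.

Lemma graph_of_sym : symmetric graph_of.
Proof. by move=> u v; rewrite /graph_of orbC. Qed.

Lemma simple_graph_of : simple_graph graph_of.
Proof.
split; first exact: graph_of_sym.
by move=> u; apply/negP; rewrite /graph_of orbb => /s_lt; rewrite ltnn.
Qed.

(** Turns a duplicate-free list of increasing pairs into a list of distinct undirected edges. *)
Lemma set2_inj_lt (x y x' y' : 'I_N) :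
  x < y -> x' < y' -> [set x; y] = [set x'; y'] -> (x, y) = (x', y').
Proof.
move=> xy xy' E.
have: x \in [set x'; y'] by rewrite -E set21.
have: y \in [set x'; y'] by rewrite -E set22.
have: x' \in [set x; y] by rewrite E set21.
rewrite !inE => /orP[]/eqP ? /orP[]/eqP ? /orP[]/eqP ?; subst => //;
  exfalso; lia.
Qed.

Lemma edge_list_graph_of : edge_list graph_of s.
Proof.
apply: uniq_perm; last 1 first.
- move=> A; rewrite mem_enum; apply/mapP/imsetP => [[p ps ->]|[p]].
    by exists p => //; rewrite inE /graph_of -surjective_pairing ps.
  rewrite inE => /orP[] ps ->; first by exists (p.1, p.2).
  by exists (p.2, p.1) => //=; rewrite setUC.
- rewrite map_inj_in_uniq // => -[x y] [x' y'] /s_lt /= xy /s_lt /= xy'.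
  exact: set2_inj_lt.
- exact: enum_uniq.
Qed.

Lemma card_edges_graph_of : #|edges graph_of| = size s.
Proof. by rewrite cardE -(perm_size edge_list_graph_of) size_map. Qed.

End EdgeList.

(** * The graph of an orthogonal vectors instance *)

Section Gadget.
Set Implicit Arguments.
Unset Strict Implicit.

Variables (n d a b q : nat) (bit : nat -> nat -> bool).

(* [Arm c k s] is the vertex at distance s + 1 from the centre c on its arm k.
   Arm k < d leads to the coordinate k if bit k of c is 1, arm d of a vector leads
   to the apex of its side, and arm d + 1 is the pendant path.  The centres
   c < n are the left vectors, the centres n <= c < 2n the right ones, and 2n and
   2n + 1 are the hubs. *)
Inductive vert := Cen of nat | Arm of nat & nat & nat | Cp of nat & nat | Yp of nat.

Definition arm (c k s : nat) : vert := if s is s'.+1 then Arm c k s' else Cen c.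

Definition apex (i : bool) : vert := arm (2 * n + i) d.+1 a.

Definition side (c : nat) : bool := if c < 2 * n then n <= c else c != 2 * n.

Definition ebit (c k : nat) : bool := (c < 2 * n) ==> bit c k.

(** The apices already exist as arm vertices or hubs; only the interior positions of the path are
    new, which shifts their index by one. *)
Definition spine (s : nat) : vert :=
  if s == 0 then apex false
  else if s == a + b + q then apex true else Yp s.-1.

Definition cend (i : bool) : nat := if i then q else 0.

(** Besides counting arms, this is the number of rounds of the printing loop; it exceeds every round
    in which some entry has to be active. *)
Definition narms : nat := (2 * n + 2) * (d + 2).

Definition num (v : vert) : nat :=
  match v with
  | Cen c => c
  | Arm c k s => 2 * n + 2 + ((c * (d + 2) + k) * a + s)
  | Cp k s => 2 * n + 2 + (narms * a + (k * (q + 1) + s))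
  | Yp s => 2 * n + 2 + (narms * a + (d * (q + 1) + s))
  end.

Definition valid (v : vert) : bool :=
  match v with
  | Cen c => c < 2 * n + 2
  | Arm c k s => [&& c < 2 * n + 2, k < d + 2 & s < a]
  | Cp k s => (k < d) && (s <= q)
  | Yp s => s.+1 < a + b + q
  end.

(** One less than the number of vertices, so that the vertex type is visibly nonempty, as [inord]
    demands. *)
Definition order_pred : nat :=
  2 * n + 1 + (narms * a + (d * (q + 1) + (a + b + q).-1)).

Definition vx (v : vert) : 'I_order_pred.+1 := inord (num v).

(** Inverse of [num] on valid vertices: centres, arms, coordinate paths and spine occupy consecutive
    blocks, and division recovers the digits within a block. *)
Definition denum (x : nat) : vert :=
  if x < 2 * n + 2 then Cen x else
  let y := x - (2 * n + 2) in
  if y < narms * a then Arm (y %/ a %/ (d + 2)) (y %/ a %% (d + 2)) (y %% a) else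
  let z := y - narms * a in
  if z < d * (q + 1) then Cp (z %/ (q + 1)) (z %% (q + 1))
  else Yp (z - d * (q + 1)).

(* In round t, the entry j contributes the edge [ends j t] if [active j t] holds.
   The last edge of the spine is reversed so that all edges go from a smaller to a
   larger number. *)
Definition ends (j : nat * nat) (t : nat) : vert * vert :=
  let s := j.2 in
  match j.1 with
  | 0 => (arm (t %/ (d + 2)) (t %% (d + 2)) s, arm (t %/ (d + 2)) (t %% (d + 2)) s.+1)
  | 1 => (arm (t %/ d) (t %% d) b.-1, Cp (t %% d) (cend (n * d <= t)))
  | 2 => (arm t d b.-1, apex (n <= t))
  | 3 => (arm (2 * n + (d <= t)) (t %% d) b.-1, Cp (t %% d) (cend (d <= t)))
  | 4 => (Cp t s, Cp t s.+1)
  | _ => if (0 < s) && (s.+1 == a + b + q) then (spine s.+1, spine s)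
         else (spine s, spine s.+1)
  end.

Definition active (j : nat * nat) (t : nat) : bool :=
  match j.1 with
  | 0 => true
  | 1 => (t < 2 * n * d) && bit (t %/ d) (t %% d)
  | 2 => t < 2 * n
  | 3 => t < 2 * d
  | 4 => t < d
  | _ => t < 1
  end.

Definition entries : seq (nat * nat) :=
  [seq (0, s) | s <- iota 0 a] ++ [:: (1, 0); (2, 0); (3, 0)]
  ++ [seq (4, s) | s <- iota 0 q] ++ [seq (5, s) | s <- iota 0 (a + b + q)].

Definition gadget_edges : seq ('I_order_pred.+1 * 'I_order_pred.+1) :=
  [seq (vx (ends j t).1, vx (ends j t).2) |
    t <- iota 0 narms, j <- [seq j <- entries | active j t]].

Definition gadget : rel 'I_order_pred.+1 := graph_of gadget_edges.

Hypotheses (n_gt0 : 0 < n) (b_gt0 : 0 < b) (ab : a <= b) (ba : b <= a.+1).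

Lemma mem_entries j : (j \in entries) =
  match j.1 with
  | 0 => j.2 < a
  | 1 | 2 | 3 => j.2 == 0
  | 4 => j.2 < q
  | 5 => j.2 < a + b + q
  | _ => false
  end.
Proof.
have mem_tag (g m : nat) : (j \in [seq (g, s) | s <- iota 0 m]) =
    (j.1 == g) && (j.2 < m).
  apply/mapP/andP => [[s]|[/eqP<- s_lt]].
    by rewrite mem_iota => /andP[_ s_lt] ->; rewrite eqxx.
  by exists j.2; rewrite ?mem_iota -?surjective_pairing.
rewrite /entries !mem_cat !mem_tag !inE.
by case: j {mem_tag} => [[|[|[|[|[|[|g]]]]]] s] /=; rewrite ?xpair_eqE /= ?orbF.
Qed.

(** * The numbering of the vertices *)

Lemma numK v : valid v -> denum (num v) = v.
Proof.
have digit x m y : y < m -> ((x * m + y) %/ m = x) * ((x * m + y) %% m = y).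
  move=> ym; rewrite divnMDl ?modnMDl ?(leq_ltn_trans _ ym) //.
  by rewrite divn_small // modn_small // addn0.
rewrite /denum; case: v => [c|c k s|k s|s] /=.
- by move=> ->.
- move=> /and3P[cn kd sa].
  rewrite ltnNge leq_addr /= addKn.
  have ck : c * (d + 2) + k < narms by rewrite /narms; nia.
  have -> : (c * (d + 2) + k) * a + s < narms * a by nia.
  by rewrite !digit.
- move=> /andP[kd sq].
  rewrite ltnNge leq_addr /= addKn ltnNge leq_addr /= addKn.
  have -> : k * (q + 1) + s < d * (q + 1) by nia.
  by rewrite !digit // addn1.
- move=> _; rewrite ifF ?addKn; last lia.
  rewrite ifF; last lia.
  rewrite ifF; last lia.
  by congr Yp; lia.
Qed.

Lemma num_lt v : valid v -> num v < order_pred.+1.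
Proof.
rewrite /order_pred; case: v => [c|c k s|k s|s] /=.
- by move=> ?; lia.
- move=> /and3P[cn kd sa].
  have ck : c * (d + 2) + k < narms by rewrite /narms; nia.
  have : (c * (d + 2) + k) * a + s < narms * a by nia.
  lia.
- move=> /andP[kd sq].
  have : k * (q + 1) + s < d * (q + 1) by nia.
  lia.
- lia.
Qed.

Lemma denumK x : x < order_pred.+1 -> valid (denum x) /\ num (denum x) = x.
Proof.
rewrite /denum /order_pred => x_lt; case: ifP => [//|/negbT x_ge].
set y := x - _; case: ifP => [y_lt|/negbT y_ge] /=.
  have a_gt0 : 0 < a by case: (a) y_lt => //; rewrite muln0.
  rewrite -!divn_eq; split; last by rewrite /y; lia.
  have d_gt0 : 0 < d + 2 by rewrite addn2.
  rewrite (ltn_pmod _ d_gt0) (ltn_pmod _ a_gt0) !andbT.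
  by rewrite !ltn_divLR // -/narms.
set z := y - _; case: ifP => [z_lt|/negbT z_ge] /=.
  rewrite -divn_eq; split; last by rewrite /z /y; lia.
  have q1_gt0 : 0 < q + 1 by rewrite addn1.
  by rewrite ltn_divLR // z_lt -ltnS -[q.+1]addn1 ltn_pmod.
split; rewrite /z /y; lia.
Qed.

(** * Validity, orientation and distinctness of the listed edges *)

Lemma valid_arm c k s :
  c < 2 * n + 2 -> k < d + 2 -> s <= a -> valid (arm c k s).
Proof. by case: s => [|s] cn kd sa //=; rewrite cn kd. Qed.

Lemma valid_apex i : valid (apex i).
Proof. by apply: valid_arm => //; case: i; lia. Qed.

Lemma valid_spine s : s <= a + b + q -> valid (spine s).
Proof.
rewrite /spine; case: eqP => [_|?]; first by rewrite valid_apex.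
by case: eqP => [_|? ?] /=; [rewrite valid_apex | lia].
Qed.

Lemma valid_ends j t : j \in entries -> t < narms -> active j t ->
  valid (ends j t).1 && valid (ends j t).2.
Proof.
rewrite mem_entries /narms; case: j => [[|[|[|[|[|[|g]]]]]] s] //=.
- move=> sa t_lt _.
  have ? : t %/ (d + 2) < 2 * n + 2 by rewrite ltn_divLR // addn_gt0 orbT.
  have ? : t %% (d + 2) < d + 2 by rewrite ltn_pmod // addn_gt0 orbT.
  by rewrite valid_arm ?(ltnW sa) //= sa; apply/and3P.
- rewrite /active /= => _ _ /andP[t_lt _].
  have d_gt0 : 0 < d by case: (d) t_lt => //; rewrite muln0.
  have ? : t %/ d < 2 * n by rewrite ltn_divLR.
  have ? : t %% d < d by rewrite ltn_pmod.
  rewrite valid_arm /=; try lia.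
  by apply/andP; split=> //; rewrite /cend; case: ifP.
- rewrite /active /= => _ _ t_lt; rewrite valid_arm ?valid_apex //; lia.
- rewrite /active /= => _ _ t_lt.
  have d_gt0 : 0 < d by lia.
  have ? : t %% d < d by rewrite ltn_pmod.
  rewrite valid_arm /=; try (case: (d <= t); lia).
  by apply/andP; split=> //; rewrite /cend; case: ifP.
- by rewrite /active /= => sq _ ->; rewrite (ltnW sq).
- rewrite /ends /= => s_lt _ _.
  by case: ifP => _ /=; rewrite !valid_spine //; lia.
Qed.

Lemma num_arm_lt c k s :
  c < 2 * n + 2 -> k < d + 2 -> s <= a ->
  num (arm c k s) < 2 * n + 2 + narms * a.
Proof.
case: s => [|s] cn kd sa /=; first lia.
have ck : c * (d + 2) + k < narms by rewrite /narms; nia.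
have : (c * (d + 2) + k) * a + s < narms * a by nia.
lia.
Qed.

Lemma num_arm c k s : num (arm c k s) =
  if s == 0 then c else 2 * n + 2 + ((c * (d + 2) + k) * a + s.-1).
Proof. by case: s. Qed.

(** Centres come first, then the arms in lexicographic order, then coordinate paths and spine, so
    edges go upwards. The last spine edge, from a [Yp] vertex to an apex, would go down, and [ends]
    reverses it. *)
Lemma num_ends_lt j t : j \in entries -> t < narms -> active j t ->
  num (ends j t).1 < num (ends j t).2.
Proof.
rewrite mem_entries; case: j => [[|[|[|[|[|[|g]]]]]] s] //=.
- case: s => [|s] sa t_lt _ /=; last by lia.
  have : t %/ (d + 2) < 2 * n + 2 by rewrite ltn_divLR // addn_gt0 orbT.
  lia.
- rewrite /active /= => _ _ /andP[t_lt _].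
  have d_gt0 : 0 < d by case: (d) t_lt => //; rewrite muln0.
  have ? : t %/ d < 2 * n by rewrite ltn_divLR.
  have ? : t %% d < d by rewrite ltn_pmod.
  have := @num_arm_lt (t %/ d) (t %% d) b.-1.
  lia.
- rewrite /active /= => _ _ t_lt; rewrite /apex.
  (* Arm [d] of a vector precedes the pendant arm of a hub; if [b.-1] or [a] is 0, the end in
     question is a centre. *)
  have arms_lt : t * (d + 2) + d < (2 * n + (n <= t)) * (d + 2) + d.+1.
    by rewrite -addnS leq_add2r leq_mul2r ltnW ?orbT // (leq_trans t_lt) ?leq_addr.
  have := leq_mul arms_lt (leqnn a); rewrite mulSn.
  rewrite !num_arm; case: (posnP b.-1) => ?; case: (posnP a) => ?; lia.
- rewrite /active /= => _ _ t_lt.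
  have d_gt0 : 0 < d by lia.
  have ? : t %% d < d by rewrite ltn_pmod.
  have := @num_arm_lt (2 * n + (d <= t)) (t %% d) b.-1.
  lia.
- lia.
- have lt_apex i : num (apex i) < 2 * n + 2 + narms * a.
    by apply: num_arm_lt => //; case: i; lia.
  have apex_lt : num (apex false) < num (apex true).
    rewrite /apex !num_arm; case: posnP => ?; first lia.
    have arms_lt : (2 * n + 0) * (d + 2) + d.+1 < (2 * n + 1) * (d + 2) + d.+1 by nia.
    have := leq_mul arms_lt (leqnn a); rewrite mulSn; lia.
  rewrite /ends /spine /= => s_lt _ _; have := (lt_apex true, lt_apex false).
  case: s s_lt => [|s] s_lt [lt1 lt2] /=.
    by case: ifP => _ //=; lia.
  case: eqP => [E|NE] /=.
    by case: eqP => /=; lia.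
  by case: eqP => /=; lia.
Qed.

Lemma num_inj u v : valid u -> valid v -> num u = num v -> u = v.
Proof. by move=> /numK {2}<- /numK {2}<- ->. Qed.

Lemma vxK v : valid v -> vx v = num v :> nat.
Proof. by move=> /num_lt v_lt; rewrite /vx inordK. Qed.

Lemma arm_inj c k s c' k' s' : arm c k s = arm c' k' s' ->
  (c = c') * (s = s') * (0 < s -> k = k').
Proof. by case: s => [|s]; case: s' => [|s'] //= -[-> // -> ->]. Qed.

Lemma arm_Cp c k s k' s' : arm c k s <> Cp k' s'.
Proof. by case: s. Qed.

Lemma arm_Yp c k s s' : arm c k s <> Yp s'.
Proof. by case: s. Qed.

Arguments arm : simpl never.

Lemma ends_inj j j' t t' :
  j \in entries -> j' \in entries -> t < narms -> t' < narms ->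
  active j t -> active j' t' -> ends j t = ends j' t' -> (t, j) = (t', j').
Proof.
have Cp_inj k k' s s' : Cp k s = Cp k' s' -> k = k' /\ s = s' by case.
have Yp_inj s s' : Yp s = Yp s' -> s = s' by case.
rewrite !mem_entries.
case: j j' => [[|[|[|[|[|[|g]]]]]] s] [[|[|[|[|[|[|g']]]]]] s'] //=;
  rewrite /active /ends /= /spine /apex => Hs Hs' Ht Ht' At At';
  (repeat match goal with
  | |- context [if ?c then _ else _] => let H := fresh "B" in case: (boolP c) => H //=
  end) => /pair_equal_spec[];
  do 2?[move=> /arm_inj[[Ec Es] Ek] | move=> /arm_Cp [] | move=> /arm_Yp []
        | move=> /esym /arm_Cp [] | move=> /esym /arm_Yp []
        | move=> /Cp_inj [Hk ?] | move=> /Cp_inj [? ?] | move=> /Yp_inj ?] => //;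
          try (exfalso; lia).
(* The second end is used: for [s] equal to 0 the first one is the centre and forgets the arm. *)
- move=> /arm_inj[[_ _] /(_ isT) Em].
  by rewrite (divn_eq t (d + 2)) Ec Em -divn_eq Es.
(* An edge inside an arm keeps its centre, whereas an edge to an apex passes from a vector to a
   hub. *)
- by move=> /arm_inj[[? _] _]; exfalso; lia.
- by rewrite (divn_eq t d) Ec Hk -divn_eq (eqP Hs) (eqP Hs').
- by move=> /arm_inj[[? _] _]; exfalso; lia.
- by rewrite Ec (eqP Hs) (eqP Hs').
- have div2 u : u < 2 * d -> u %/ d = (d <= u).
    move=> u_lt; case: leqP => d_le; last exact: divn_small.
    by apply/eqP; rewrite eqn_leq -ltnS ltn_divLR ?leq_divRL; lia.
  rewrite (divn_eq t d) Hk div2 // (_ : (d <= t) = (d <= t')); last lia.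
  by rewrite -div2 // -divn_eq (eqP Hs) (eqP Hs').
all: by move=> *; congr pair; [lia | congr pair; lia].
Qed.

Lemma uniq_gadget_edges : uniq gadget_edges.
Proof.
apply: allpairs_uniq_dep; first exact: iota_uniq.
  move=> t _; apply: filter_uniq; rewrite /entries.
  have tagP (g m : nat) j : j \in [seq (g, s) | s <- iota 0 m] -> j.1 = g.
    by case/mapP => s _ ->.
  rewrite !cat_uniq !map_inj_uniq ?iota_uniq; try by move=> ? ? [].
  do 5?[apply/andP; split=> //]; rewrite ?andbT; apply/hasPn => j.
  - rewrite !inE !mem_cat => H; apply/negP => /tagP E; move: H E.
    by case/or3P => [/eqP->|/eqP->|/orP[/eqP->|/orP[]/tagP ->]].
  - rewrite mem_cat !inE => H; apply/negP => E; move: H.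
    by case/orP => /tagP; move: E; case/or3P => /eqP ->.
  - by move=> /tagP E; apply/negP => /tagP; rewrite E.
have memP p : p \in [seq existT (fun=> (nat * nat)%type) t j |
      t <- iota 0 narms, j <- [seq j <- entries | active j t]] ->
    [/\ tag p < narms, tagged p \in entries & active (tagged p) (tag p)].
  case/allpairsPdep => t [j [t_in j_in ->]] /=.
  move: t_in j_in; rewrite mem_iota mem_filter => /andP[_ ?] /andP[? ?]. by split.
move=> [t j] [t' j'] /memP[/= lt jE act] /memP[/= lt' jE' act'].
case => /(congr1 val) E1 /(congr1 val) E2.
have /andP[V1 V2] := valid_ends jE lt act.
have /andP[V1' V2'] := valid_ends jE' lt' act'.
have E : ends j t = ends j' t'.
  by apply: injective_projections; apply: num_inj => //; rewrite -!vxK.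
by have [-> ->] := ends_inj jE jE' lt lt' act act' E.
Qed.

Lemma gadget_edges_lt p : p \in gadget_edges -> p.1 < p.2.
Proof.
move=> /allpairsPdep[t [j []]]; rewrite mem_iota mem_filter.
move=> /andP[_ t_lt] /andP[act jE] -> /=; have /andP[V1 V2] := valid_ends jE t_lt act.
by rewrite !vxK // num_ends_lt.
Qed.

(** * Upper bounds on distances *)

Definition within (u v : vert) (k : nat) : Prop := dist_le gadget (vx u) (vx v) k.

Lemma within_trans v u w j k : within u v j -> within v w k -> within u w (j + k).
Proof. exact: dist_le_trans. Qed.

Lemma within_sym u v k : within u v k -> within v u k.
Proof. by apply: dist_le_sym; apply: graph_of_sym. Qed.

Lemma withinW u v j k : j <= k -> within u v j -> within u v k.
Proof. exact: dist_leW. Qed.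

Lemma within_ends j t : j \in entries -> t < narms -> active j t ->
  within (ends j t).1 (ends j t).2 1.
Proof.
move=> jE t_lt act; apply: dist_le1; rewrite /gadget /graph_of.
apply/orP; left; apply/allpairsPdep; exists t, j.
by rewrite mem_iota mem_filter act.
Qed.

Lemma divmod_digits c k m : k < m -> ((c * m + k) %/ m = c) * ((c * m + k) %% m = k).
Proof.
by move=> km; rewrite divnMDl ?(leq_ltn_trans _ km) // divn_small // addn0 modnMDl
  modn_small.
Qed.

Lemma within_arm1 c k s : c < 2 * n + 2 -> k < d + 2 -> s < a ->
  within (arm c k s) (arm c k s.+1) 1.
Proof.
move=> cn kd sa; have := @within_ends (0, s) (c * (d + 2) + k).
rewrite /ends /= !divmod_digits // mem_entries; apply=> //.
by rewrite /narms; nia.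
Qed.

(** All arms have length [a]; the path of length [b] to a coordinate leaves its arm at position
    [b.-1], which exists since [b] is [a] or [a.+1]. Vectors use the entry of kind 1, hubs that of
    kind 3. *)
Lemma within_bit c k : c < 2 * n + 2 -> k < d -> ebit c k ->
  within (arm c k b.-1) (Cp k (cend (side c))) 1.
Proof.
rewrite /ebit /side => cn kd; case: ltnP => [c_lt|c_ge] /= kbit.
  have := @within_ends (1, 0) (c * d + k).
  rewrite /ends /active /= !divmod_digits // mem_entries kbit.
  have -> : (n * d <= c * d + k) = (n <= c).
    by case: (leqP n c) => nc; nia.
  have -> : c * d + k < 2 * n * d by nia.
  by apply=> //; rewrite /narms; nia.
have := @within_ends (3, 0) ((c - 2 * n) * d + k).
rewrite /ends /active /= !divmod_digits // mem_entries /=.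
have -> : (d <= (c - 2 * n) * d + k) = (c != 2 * n) by case: eqP; nia.
rewrite (_ : 2 * n + _ = c); last by case: eqP; lia.
apply=> //; rewrite /narms; nia.
Qed.

Lemma within_apex1 c : c < 2 * n -> within (arm c d b.-1) (apex (side c)) 1.
Proof.
move=> c_lt; rewrite /side c_lt.
apply: (@within_ends (2, 0) c); rewrite ?mem_entries //.
by rewrite /narms; nia.
Qed.

Lemma within_Cp1 k s : k < d -> s < q -> within (Cp k s) (Cp k s.+1) 1.
Proof.
move=> kd sq; apply: (@within_ends (4, s) k); rewrite ?mem_entries //.
by rewrite /narms; nia.
Qed.

Lemma within_spine1 s : s < a + b + q -> within (spine s) (spine s.+1) 1.
Proof.
move=> s_lt; have := @within_ends (5, s) 0.
rewrite mem_entries /ends /=.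
have -> : 0 < narms by rewrite /narms; nia.
move=> /(_ s_lt isT isT); by case: ifP => _ //= /within_sym.
Qed.

Lemma within_chain (v : nat -> vert) m i j :
  (forall s, s < m -> within (v s) (v s.+1) 1) -> i <= j -> j <= m ->
  within (v i) (v j) (j - i).
Proof.
move=> H; elim: j => [|j IH] ij jm.
  by move: ij; rewrite leqn0 => /eqP ->; apply: dist_le0.
move: ij; rewrite leq_eqVlt => /orP[/eqP->|ij].
  by rewrite subnn; apply: dist_le0.
by rewrite subSn // -[_.+1 in X in within _ _ X]addn1;
  apply: within_trans (IH ij (ltnW jm)) (H _ jm).
Qed.

Lemma within_center c k s : c < 2 * n + 2 -> k < d + 2 -> s <= a ->
  within (Cen c) (arm c k s) s.
Proof.
move=> cn kd sa; rewrite -{2}(subn0 s).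
apply: (@within_chain (arm c k) a) => // i; exact: within_arm1.
Qed.

Lemma within_center_Cp c k : c < 2 * n + 2 -> k < d -> ebit c k ->
  within (Cen c) (Cp k (cend (side c))) b.
Proof.
move=> cn kd kbit; rewrite -(prednK b_gt0) -addn1.
apply: within_trans (within_bit cn kd kbit).
by apply: within_center => //; lia.
Qed.

Lemma within_center_apex c : c < 2 * n + 2 -> within (Cen c) (apex (side c)) b.
Proof.
move=> cn; case: (ltnP c (2 * n)) => [c_lt|c_ge].
  rewrite -(prednK b_gt0) -addn1; apply: within_trans (within_apex1 c_lt).
  by apply: within_center => //; lia.
apply: withinW ab _; rewrite /apex /side ltnNge c_ge /=.
rewrite (_ : 2 * n + _ = c); last by case: eqP; lia.
by apply: within_center => //; lia.
Qed.

Lemma within_hub_apex (i : bool) : within (Cen (2 * n + i)) (apex i) a.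
Proof. by apply: within_center => //; case: i; lia. Qed.

Lemma within_arm_apex c k s : c < 2 * n + 2 -> k < d + 2 -> s <= a ->
  within (arm c k s) (apex (side c)) (a + b).
Proof.
move=> cn kd sa; apply: withinW (within_trans (within_sym (within_center cn kd sa))
  (within_center_apex cn)).
lia.
Qed.

Lemma within_Cp k i j : k < d -> i <= j -> j <= q -> within (Cp k i) (Cp k j) (j - i).
Proof. by move=> kd ij jq; apply: (within_chain (m := q)) => // s;
  apply: within_Cp1. Qed.

Lemma within_spine i j : i <= j -> j <= a + b + q ->
  within (spine i) (spine j) (j - i).
Proof. by move=> ij jm; apply: (within_chain (m := a + b + q)) => //;
  apply: within_spine1. Qed.

(** The hub on side [i] is joined to every coordinate, which gives a route of length [b + a] from
    the end of the coordinate path to the apex. *)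
Lemma within_Cp_apex k s (i : bool) : k < d -> s <= q ->
  within (Cp k s) (apex i) (a + b + (if i then q - s else s)).
Proof.
move=> kd sq.
have hub_lt : 2 * n + i < 2 * n + 2 by case: i; lia.
have hub_bit : ebit (2 * n + i) k by rewrite /ebit ltnNge leq_addr.
have hub_side : side (2 * n + i) = i.
  by rewrite /side ltnNge leq_addr /=; case: i {hub_lt hub_bit}; apply/eqP; lia.
have := within_center_Cp hub_lt kd hub_bit; rewrite hub_side => /within_sym E.
have := within_trans E (within_hub_apex i) => F.
rewrite addnC (addnC a); apply: within_trans F.
rewrite /cend; case: i {E hub_lt hub_bit hub_side}.
  exact: within_Cp.
by rewrite -{2}(subn0 s); apply: within_sym; apply: within_Cp.
Qed.

Lemma spine_last : spine (a + b + q) = apex true.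
Proof. by rewrite /spine eqxx; case: eqP => // ?; lia. Qed.

Lemma within_apexes : within (apex false) (apex true) (a + b + q).
Proof.
by have := @within_spine 0 (a + b + q) (leq0n _) (leqnn _); rewrite subn0 spine_last.
Qed.

Lemma within_spine_apex s (i : bool) : s <= a + b + q ->
  within (spine s) (apex i) (if i then a + b + q - s else s).
Proof.
move=> sm; case: i; first by rewrite -spine_last; apply: within_spine.
by have := within_spine (leq0n s) sm; rewrite subn0 => /within_sym.
Qed.

Definition apex_bound (v : vert) (x y : nat) : Prop :=
  within v (apex false) x /\ within v (apex true) y.

Lemma within_via_apex u v x y x' y' D :
  apex_bound u x y -> apex_bound v x' y' ->
  (x + x' <= D) || (y + y' <= D) -> within u v D.
Proof.
move=> [ux uy] [vx' vy'] /orP[] xD; apply: withinW xD _.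
  exact: within_trans ux (within_sym vx').
exact: within_trans uy (within_sym vy').
Qed.

Lemma apex_bound_arm c k s : c < 2 * n + 2 -> k < d + 2 -> s <= a ->
  let far := (a + b) + (a + b + q) in
  if side c then apex_bound (arm c k s) far (a + b)
  else apex_bound (arm c k s) (a + b) far.
Proof.
move=> cn kd sa /=; have := within_arm_apex cn kd sa.
case: (side c) => H; split=> //; apply: within_trans H _.
  exact: within_sym within_apexes.
exact: within_apexes.
Qed.

Definition is_arm (v : vert) (c k s : nat) : Prop :=
  [/\ v = arm c k s, c < 2 * n + 2, k < d + 2 & s <= a].

(** Vertices off the arms lie on a coordinate path or on the spine, so moving away from one apex
    means approaching the other; hence the bound on [x + y]. *)
Lemma arm_or_middle v : valid v -> (exists c k s, is_arm v c k s) \/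
  exists x y, [/\ apex_bound v x y, x <= a + b + q, y <= a + b + q
                 & x + y <= 2 * (a + b) + q].
Proof.
case: v => [c|c k s|k s|s] /=.
- by move=> cn; left; exists c, 0, 0; split=> //; lia.
- by case/and3P => cn kd sa; left; exists c, k, s.+1.
- case/andP => kd sq; right; exists (a + b + s), (a + b + (q - s)).
  split; try lia; split; first exact: (within_Cp_apex false kd sq).
  exact: (within_Cp_apex true kd sq).
- move=> s_lt; right; exists s.+1, (a + b + q - s.+1); split; try lia.
  have -> : Yp s = spine s.+1 by rewrite /spine /=; case: eqP => //; lia.
  split; first exact: (within_spine_apex false (ltnW s_lt)).
  exact: (within_spine_apex true (ltnW s_lt)).
Qed.

(** Let l = a + b. Two arms of one side meet at their apex after 2l; an arm and a middle vertex need
    at most l + (l + q); for two middle vertices the bounds for the routes over the two apices add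
    up to at most 4l + 2q, so one of them is short enough. Only arms of opposite sides remain. *)
Lemma within_dichotomy u v : valid u -> valid v ->
  within u v (2 * (a + b) + q) \/ within u v (3 * (a + b) + q) /\
  exists c k s c' k' s', [/\ is_arm u c k s, is_arm v c' k' s' & side c != side c'].
Proof.
move=> /arm_or_middle[[c [k [s U]]]|[x [y [Bu xl yl xy]]]].
  move=> /arm_or_middle[[c' [k' [s' V]]]|[x' [y' [Bv xl' yl' xy']]]].
    have := U; have := V; rewrite /is_arm.
    move=> [Ev cn' kd' sa'] [Eu cn kd sa].
    have := apex_bound_arm cn kd sa; have := apex_bound_arm cn' kd' sa'.
    rewrite /= -Eu -Ev; case E : (side c); case E' : (side c') => H' H.
    - by left; apply: within_via_apex H H' _; lia.
    - right; split; first by apply: within_via_apex H H' _; lia.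
      by exists c, k, s, c', k', s'; rewrite E E'.
    - right; split; first by apply: within_via_apex H H' _; lia.
      by exists c, k, s, c', k', s'; rewrite E E'.
    - by left; apply: within_via_apex H H' _; lia.
  case: U => -> cn kd sa; have := apex_bound_arm cn kd sa.
  by case: (side c) => H; left; apply: within_via_apex H Bv _; lia.
move=> /arm_or_middle[[c [k [s [-> cn kd sa]]]]|[x' [y' [Bv xl' yl' xy']]]].
  have := apex_bound_arm cn kd sa.
  by case: (side c) => H; left; apply: within_via_apex Bu H _; lia.
by left; apply: within_via_apex Bu Bv _; lia.
Qed.

Lemma within_diameter_far u v : valid u -> valid v ->
  within u v (3 * (a + b) + q).
Proof. by move=> U V; case: (within_dichotomy U V) => [|[]] //; apply: withinW;
  lia. Qed.

Lemma within_opposite c c' k : c < 2 * n + 2 -> c' < 2 * n + 2 -> k < d ->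
  ebit c k -> ebit c' k -> side c = false -> side c' ->
  within (Cen c) (Cen c') (b + q + b).
Proof.
move=> cn cn' kd kc kc' sc sc'.
have := within_center_Cp cn kd kc; rewrite sc => H.
have := within_center_Cp cn' kd kc'; rewrite sc' => /within_sym.
apply: within_trans; apply: within_trans H _.
by have := @within_Cp k 0 q kd (leq0n _) (leqnn _); rewrite subn0.
Qed.

Lemma within_diameter_near u v :
  (forall i j, i < n -> n <= j < 2 * n -> exists2 k, k < d & bit i k && bit j k) ->
  valid u -> valid v -> within u v (2 * (a + b) + q).
Proof.
move=> share U V; case: (within_dichotomy U V) => // -[_].
move=> [c [k [s [c' [k' [s' []]]]]]].
wlog sc : u v c k s c' k' s' {U V} / side c = false => [wl A A' NE|].
  case E : (side c); last exact: wl A A' NE.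
  apply: within_sym; apply: wl A' A _; last by rewrite eq_sym.
  by move: NE; rewrite E; case: (side c').
move=> [-> cn kd sa] [-> cn' kd' sa'] NE.
have {NE} sc' : side c' by move: NE; rewrite sc; case: (side c').
have [m md /andP[mc mc']] : exists2 m, m < d & ebit c m && ebit c' m.
  (* A hub has all bits 1, so vector 0 or [n] stands in for it when a common coordinate is
     chosen. *)
  have [||m md /andP[m1 m2]] :=
    share (if c < 2 * n then c else 0) (if c' < 2 * n then c' else n).
  - by move: sc; rewrite /side; case: ifP => // _ /negbT; rewrite -ltnNge.
  - by move: sc'; rewrite /side; case: ifP => //; lia.
  exists m => //; rewrite /ebit; move: m1 m2.
  by do 2![case: ifP => _ /=] => // -> // ->.
have := within_trans (within_trans (within_sym (within_center cn kd sa))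
  (within_opposite cn cn' md mc mc' sc sc')) (within_center cn' kd' sa').
by apply: withinW; lia.
Qed.

(** * Lower bounds on distances by a potential *)

Definition near (x y : nat) : bool := (x <= y.+1) && (y <= x.+1).

(** [near] is symmetric, so the orientation of the listed edges does not matter; vectors and hubs
    share one clause for the edges to coordinates. *)
Lemma gadget_potential (f : vert -> nat) :
  (forall c k s, c < 2 * n + 2 -> k < d + 2 -> s < a ->
     near (f (arm c k s)) (f (arm c k s.+1))) ->
  (forall c k, c < 2 * n + 2 -> k < d -> ebit c k ->
     near (f (arm c k b.-1)) (f (Cp k (cend (side c))))) ->
  (forall c, c < 2 * n -> near (f (arm c d b.-1)) (f (apex (side c)))) ->
  (forall k s, k < d -> s < q -> near (f (Cp k s)) (f (Cp k s.+1))) ->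
  (forall s, s < a + b + q -> near (f (spine s)) (f (spine s.+1))) ->
  forall x y, gadget x y -> f (denum y) <= (f (denum x)).+1.
Proof.
move=> Harm Hbit Hapex HCp Hspine.
suff H x y : (x, y) \in gadget_edges -> near (f (denum x)) (f (denum y)).
  by move=> x y /orP[] /H /andP[].
move=> /allpairsPdep[t [j []]]; rewrite mem_iota mem_filter.
move=> /andP[_ t_lt] /andP[act jE] [-> ->].
have /andP[V1 V2] := valid_ends jE t_lt act.
rewrite !vxK // !numK //; move: jE act t_lt {V1 V2}.
rewrite mem_entries /active /ends /narms.
case: j => [[|[|[|[|[|[|g]]]]]] s] //=.
- move=> sa _ t_lt; apply: Harm => //.
    by rewrite ltn_divLR // addn_gt0 orbT.
  by rewrite ltn_pmod // addn_gt0 orbT.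
- move=> _ /andP[t_lt tbit] _.
  have d_gt0 : 0 < d by case: (d) t_lt => //; rewrite muln0.
  have c_lt : t %/ d < 2 * n by rewrite ltn_divLR.
  have := Hbit (t %/ d) (t %% d); rewrite /ebit /side c_lt /= leq_divRL //.
  by apply=> //; [lia | rewrite ltn_pmod].
- by move=> _ t_lt _; have := Hapex t t_lt; rewrite /side t_lt.
- move=> _ t_lt _; have d_gt0 : 0 < d by lia.
  have hub : (2 * n + (d <= t) < 2 * n) = false by rewrite ltnNge leq_addr.
  have := Hbit (2 * n + (d <= t)) (t %% d); rewrite /ebit /side hub /=.
  have -> : (2 * n + (d <= t) != 2 * n) = (d <= t) by case: (d <= t); lia.
  by apply=> //; [case: (d <= t); lia | rewrite ltn_pmod].
- by move=> sq td _; apply: HCp.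
- move=> s_lt _ _; case: ifP => _ /=; last exact: Hspine.
  by rewrite /near andbC; apply: Hspine.
Qed.

(* The caps l and 2l yield the lower bounds 2l + q and 3l + q. *)
Section Potential.
Variables (i0 j0 cap : nat) (tau tau' : nat -> bool).
Hypotheses (i0_lt : i0 < n) (j0_ge : n <= j0) (j0_lt : j0 < 2 * n).
Hypothesis tauP : forall k, k < d -> bit i0 k -> tau k.
Hypothesis tauP' : forall k, k < d -> bit j0 k -> tau' k.
Hypothesis capP : cap = a + b \/ cap = 2 * (a + b) /\ forall k, tau' k = ~~ tau k.

(* Lower bound for the distance to the pendant tip of the centre o, where [th k]
   says that the near end of the coordinate k is assumed at distance l, not 2l. *)
Definition side_potential (o : nat) (th : nat -> bool) (c k s : nat) : nat :=
  if c == o then if k == d.+1 then a - s else a + s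
  else if c < 2 * n then
    if k == d.+1 then a + b + b
    else if (k == d) || th k then a + b + (b - s)
    else minn (a + b + b + s) (2 * (a + b))
  else if k == d.+1 then a + b + (a - s)
  else if k == d then a + b + a
  else if th k then a + b + minn a (b - s)
  else a + b + a + s.

(** The left side is measured from the tip of [i0], the right side backwards from the tip of [j0],
    whose value is [cap + (a + b) + q]. *)
Definition arm_potential (c k s : nat) : nat :=
  if side c then cap + (a + b) + q - minn (side_potential j0 tau' c k s) cap
  else minn (side_potential i0 tau c k s) cap.

(** A coordinate path rises by one per step from its left end. The spine does so only until it
    reaches [cap + q], the value of the right apex. *)
Definition potential (v : vert) : nat :=
  match v with
  | Cen c => arm_potential c 0 0
  | Arm c k s => arm_potential c k s.+1
  | Cp k s => minn (if tau k then a + b else 2 * (a + b)) cap + s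
  | Yp s => a + b + minn s.+1 (cap + q - (a + b))
  end.

(** All arms of a centre agree at position 0, so reading the value of the centre on arm 0 is
    harmless. *)
Lemma side_potential_center o th c k :
  side_potential o th c k 0 = side_potential o th c 0 0.
Proof.
rewrite /side_potential; case: (c == o); case: (c < 2 * n);
  case: (k == d.+1); case: (k == d); case: (th k); case: (0 == d.+1);
  case: (0 == d); case: (th 0) => //=; lia.
Qed.

Lemma potential_arm c k s : potential (arm c k s) = arm_potential c k s.
Proof.
by case: s => [|s] //; rewrite /= /arm_potential !(side_potential_center _ _ _ k).
Qed.

Lemma potential_apex i : potential (apex i) = if i then cap + q else a + b.
Proof.
rewrite potential_arm /arm_potential /side_potential eqxx subnn.
have hub : (2 * n + i < 2 * n) = false by rewrite ltnNge leq_addr.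
have -> : side (2 * n + i) = i by rewrite /side hub; case: (i) {hub}; lia.
have neq o : o < 2 * n -> (2 * n + i == o) = false by case: (i); lia.
by rewrite hub !neq //; [case: (i); case: capP; lia | lia].
Qed.

Lemma potential_spine s : s <= a + b + q ->
  potential (spine s) = a + b + minn s (cap + q - (a + b)).
Proof.
rewrite /spine; case: eqP => [->|s0]; first by rewrite potential_apex min0n addn0.
case: eqP => [->|_] sm; first by rewrite potential_apex; case: capP; lia.
by rewrite /= prednK ?lt0n //; apply/eqP.
Qed.

Lemma side_potential_step o th c k s : k < d + 2 -> s < a ->
  near (side_potential o th c k s) (side_potential o th c k s.+1).
Proof.
rewrite /near /side_potential => kd sa.
case: (c == o); case: (c < 2 * n); case: (k == d.+1); case: (k == d);
  case: (th k) => /=; lia.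
Qed.

(** The origin is within [a + b] of the tip-side distance to its coordinates, so [th] must hold
    there; for other centres the formula adapts to the value of [th k]. *)
Lemma side_potential_bit o (th : nat -> bool) c k : k < d -> (c == o -> th k) ->
  near (side_potential o th c k b.-1) (if th k then a + b else 2 * (a + b)).
Proof.
rewrite /near /side_potential => kd.
have -> : (k == d.+1) = false by lia.
have -> : (k == d) = false by lia.
case: (c == o) => [/(_ isT)->|_]; first by lia.
by case: (c < 2 * n); case: (th k) => /=; lia.
Qed.

Lemma side_potential_apex o th c : c < 2 * n ->
  near (side_potential o th c d b.-1) (a + b).
Proof.
rewrite /near /side_potential => ->; rewrite eqxx /=.
have -> : (d == d.+1) = false by lia.
by case: (c == o); lia.
Qed.

(** Capping and reflection keep values near, so edges may be checked on [side_potential] alone. *)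
Lemma near_arm c k s x y :
  (side c -> y = cap + (a + b) + q - minn x cap /\
     near (side_potential j0 tau' c k s) x) ->
  (~~ side c -> y = minn x cap /\ near (side_potential i0 tau c k s) x) ->
  near (potential (arm c k s)) y.
Proof.
rewrite potential_arm /arm_potential /near.
by case: (side c) => [/(_ isT)[-> ?] _|_ /(_ isT)[-> ?]]; lia.
Qed.

(** The two measurements meet on the coordinate paths: the value at the left end plus [q] must be
    the reflected value at the right end. With cap l all ends count as l; with cap 2l it works
    because exactly one of [tau k] and [tau' k] holds. *)
Lemma potential_lipschitz x y : gadget x y ->
  potential (denum y) <= (potential (denum x)).+1.
Proof.
move: x y; apply: gadget_potential.
- move=> c k s cn kd sa; rewrite [X in near _ X]potential_arm /arm_potential.
  have stepP o th := side_potential_step o th c kd sa.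
  case E : (side c).
    by apply: (near_arm (x := side_potential j0 tau' c k s.+1)); rewrite E.
  by apply: (near_arm (x := side_potential i0 tau c k s.+1)); rewrite E.
- move=> c k cn kd kbit; apply: (near_arm (x :=
    if (if side c then tau' k else tau k) then a + b else 2 * (a + b))) => sc.
    rewrite sc /=; split.
      by case: capP => [->|[-> ->]]; case: (tau k) => /=; try case: (tau' k); lia.
    apply: side_potential_bit => // /eqP E; apply: tauP' => //.
    by move: kbit; rewrite /ebit E j0_lt.
  rewrite (negPf sc) /= addn0; split=> //.
  apply: side_potential_bit => // /eqP E; apply: tauP => //.
  by move: kbit; rewrite /ebit E; case: ltnP => //; lia.
- move=> c cn; apply: (near_arm (x := a + b)) => sc; rewrite potential_apex.
    by rewrite sc; split; [case: capP; lia | apply: side_potential_apex].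
  by rewrite (negPf sc); split; [case: capP; lia | apply: side_potential_apex].
- by move=> k s kd sq; rewrite /near /=; lia.
- by move=> s sm; rewrite !potential_spine ?(ltnW sm) // /near; lia.
Qed.

(** The potential is 0 at the first tip and [cap + (a + b) + q] at the second. *)
Lemma walk_length_ge k :
  walk gadget (vx (arm i0 d.+1 a)) (vx (arm j0 d.+1 a)) k -> cap + (a + b) + q <= k.
Proof.
have i0v : valid (arm i0 d.+1 a) by apply: valid_arm; lia.
have j0v : valid (arm j0 d.+1 a) by apply: valid_arm; lia.
move=> /(walk_potential potential_lipschitz).
rewrite !vxK // !numK // !potential_arm /arm_potential /side_potential !eqxx subnn.
have -> : side j0 by rewrite /side j0_lt.
have -> : side i0 = false by rewrite /side; case: ifP; lia.
lia.
Qed.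

End Potential.

(** * The diameter in the two cases *)

Lemma gadget_order (x : 'I_order_pred.+1) : exists2 v, valid v & vx v = x.
Proof.
have [V E] := denumK (ltn_ord x); exists (denum x) => //.
by apply: val_inj; rewrite /= vxK.
Qed.

(** The lower bound needs nothing about the bits: with cap l, all coordinate ends may be assumed
    near on both sides, and vectors 0 and [n] serve as well as any. *)
Lemma gadget_diameter_near :
  (forall i j, i < n -> n <= j < 2 * n -> exists2 k, k < d & bit i k && bit j k) ->
  has_diameter gadget (2 * (a + b) + q).
Proof.
move=> share; apply: (has_diameterI (u := vx (arm 0 d.+1 a)) (v :=
  vx (arm n d.+1 a))).
  move=> x y; have [u U <-] := gadget_order x; have [v V <-] := gadget_order y.
  exact: within_diameter_near.
move=> k /(@walk_length_ge 0 n (a + b) (fun=> true) (fun=> true)) H.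
by rewrite mul2n -addnn; apply: H => //; [lia | left].
Qed.

(** With cap 2l the coordinates of [i] are assumed near on the left and all others near on the
    right; orthogonality says that this respects the bits of [j]. *)
Lemma gadget_diameter_far i j : i < n -> n <= j < 2 * n ->
  (forall k, k < d -> ~~ (bit i k && bit j k)) ->
  has_diameter gadget (3 * (a + b) + q).
Proof.
move=> i_lt /andP[j_ge j_lt] orth.
apply: (has_diameterI (u := vx (arm i d.+1 a)) (v := vx (arm j d.+1 a))).
  move=> x y; have [u U <-] := gadget_order x; have [v V <-] := gadget_order y.
  exact: within_diameter_far.
move=> k /(@walk_length_ge i j (2 * (a + b)) (bit i) (fun k => ~~ bit i k)) H.
rewrite (_ : 3 * (a + b) = 2 * (a + b) + (a + b)); last lia.
apply: H => //; last by right.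
by move=> m /orth; case: (bit i m) => //= /negPf->.
Qed.

End Gadget.

(** * Straight-line programs *)

Arguments exec : simpl never.
Arguments onth : simpl never.

Section Machine.
Set Implicit Arguments.
Unset Strict Implicit.

Lemma exec_add w P t1 t2 s s' :
  exec w P t1 s = Some s' -> exec w P (t1 + t2) s = exec w P t2 s'.
Proof. by move=> E; rewrite /exec addnC iterD -/(exec w P t1 s) E. Qed.

Lemma execS w P t s : exec w P t.+1 s = obind (exec w P t) (step w P s).
Proof.
rewrite /exec iterSr /=; case: (step w P s) => //=.
by elim: t => //= t ->.
Qed.

Lemma exec1 w P s : exec w P 1 s = step w P s.
Proof. by []. Qed.

Definition code_at (Q : program) (p : nat) (c : program) : Prop :=
  exists pre post, Q = pre ++ c ++ post /\ size pre = p.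

Lemma code_at_cat Q p c1 c2 :
  code_at Q p (c1 ++ c2) -> code_at Q p c1 /\ code_at Q (p + size c1) c2.
Proof.
move=> [pre [post [-> <-]]]; split; first by exists pre, (c2 ++ post); rewrite -!catA.
by exists (pre ++ c1), post; rewrite size_cat -!catA.
Qed.

Lemma code_at_onth Q p i c : code_at Q p (i :: c) -> onth Q p = Some i.
Proof.
by move=> [pre [post [-> <-]]]; rewrite onthE map_cat nth_cat size_map ltnn subnn.
Qed.

Lemma code_at_cons Q p i c : code_at Q p (i :: c) -> code_at Q p.+1 c.
Proof. by rewrite -cat1s -addn1 => /code_at_cat[]. Qed.

(** * Expressions and their compilation *)

Inductive expr :=
| Reg of nat | Cst of nat | Bin of binop & expr & expr | Fetch of expr.

Fixpoint eval (rg mm : nat -> nat) (e : expr) : nat :=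
  match e with
  | Reg x => rg x
  | Cst c => c
  | Bin o e1 e2 => eval_binop o (eval rg mm e1) (eval rg mm e2)
  | Fetch e => mm (eval rg mm e)
  end.

(* [Or] of a register with itself is a move. *)
Fixpoint compile_expr (e : expr) (r : nat) : program :=
  match e with
  | Reg x => [:: Op Or r x x]
  | Cst c => [:: Const r c]
  | Bin o e1 e2 => compile_expr e1 r ++ compile_expr e2 r.+1 ++ [:: Op o r r r.+1]
  | Fetch e => compile_expr e r ++ [:: Read r r]
  end.

Fixpoint regs_lt (r : nat) (e : expr) : bool :=
  match e with
  | Reg x => x < r
  | Cst _ => true
  | Bin _ e1 e2 => regs_lt r e1 && regs_lt r e2
  | Fetch e => regs_lt r e
  end.

(** All intermediate values are included, since a single overflow crashes the machine. *)
Fixpoint fits (w : nat) (rg mm : nat -> nat) (e : expr) : bool :=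
  (eval rg mm e < 2 ^ w) &&
  match e with
  | Bin _ e1 e2 => fits w rg mm e1 && fits w rg mm e2
  | Fetch e => fits w rg mm e
  | _ => true
  end.

Lemma eval_ext r rg rg' mm e : regs_lt r e ->
  (forall x, x < r -> rg' x = rg x) -> eval rg' mm e = eval rg mm e.
Proof.
move=> + H; elim: e => [x|c|o e1 IH1 e2 IH2|e IH] //=.
- by move/H.
- by case/andP => /IH1-> /IH2->.
- by move/IH->.
Qed.

Lemma fits_ext w r rg rg' mm e : regs_lt r e ->
  (forall x, x < r -> rg' x = rg x) -> fits w rg' mm e = fits w rg mm e.
Proof.
move=> + H; elim: e => [x|c|o e1 IH1 e2 IH2|e IH] //=.
- by move/H->.
- case/andP => e1r e2r; rewrite IH1 // IH2 //.
  by rewrite (eval_ext _ e1r H) (eval_ext _ e2r H).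
- by move=> er; rewrite IH // (eval_ext _ er H).
Qed.

Lemma regs_lt_leq r r' e : r <= r' -> regs_lt r e -> regs_lt r' e.
Proof.
move=> rr; elim: e => [x|c|o e1 IH1 e2 IH2|e IH] //=.
  by move=> xr; apply: leq_trans rr.
by case/andP => /IH1-> /IH2->.
Qed.

Lemma exec_set w Q p rg mm r v s :
  step w Q (State p rg mm) = set_reg w (State p rg mm) r v -> v < 2 ^ w ->
  s = State p.+1 (upd rg r v) mm -> exec w Q 1 (State p rg mm) = Some s.
Proof. by rewrite exec1 => -> v_lt ->; rewrite /set_reg v_lt. Qed.

(** The registers from [r] on act as a stack: the second operand is computed into [r.+1] and leaves
    the first one intact. *)
Lemma compile_exprP w Q e r p rg mm :
  code_at Q p (compile_expr e r) -> regs_lt r e -> fits w rg mm e ->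
  exists rg', [/\ exec w Q (size (compile_expr e r)) (State p rg mm) =
      Some (State (p + size (compile_expr e r)) rg' mm),
    rg' r = eval rg mm e & forall x, x < r -> rg' x = rg x].
Proof.
have upd_lt rg1 r1 v x : x < r1 -> upd rg1 r1 v x = rg1 x.
  by rewrite /upd; case: eqP => // -> ; rewrite ltnn.
have upd_eq rg1 r1 v : upd rg1 r1 v r1 = v by rewrite /upd eqxx.
elim: e r p rg => [x|c|o e1 IH1 e2 IH2|e IH] r p rg /= cd.
- rewrite andbT => xr v_lt; exists (upd rg r (rg x)); split=> [||y /upd_lt ->] //.
  apply: exec_set v_lt _; last by rewrite addn1.
  by rewrite /step /= (code_at_onth cd) /= PeanoNat.Nat.lor_diag.
- rewrite andbT => _ v_lt; exists (upd rg r c); split=> [||y /upd_lt ->] //.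
  apply: exec_set v_lt _; last by rewrite addn1.
  by rewrite /step /= (code_at_onth cd).
- case/andP => e1r e2r /and3P[v_lt f1 f2].
  have [cd1 /code_at_cat[cd2 cd3]] := code_at_cat cd.
  have [rg1 [ex1 v1 keep1]] := IH1 _ _ _ cd1 e1r f1.
  have e2r' := regs_lt_leq (leqnSn r) e2r.
  have f2' : fits w rg1 mm e2 by rewrite (fits_ext _ _ e2r keep1).
  have [rg2 [ex2 v2 keep2]] := IH2 _ _ _ cd2 e2r' f2'.
  rewrite (eval_ext mm e2r keep1) in v2.
  set v := eval_binop _ _ _ in v_lt *.
  exists (upd rg2 r v); split=> [||y yr] //.
    rewrite !size_cat (exec_add _ ex1) (exec_add _ ex2) /=.
    apply: exec_set v_lt _; last by rewrite !addnA addn1.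
    rewrite /step /= (code_at_onth cd3) v2.
    by rewrite keep2 // v1.
  by rewrite upd_lt // keep2 ?keep1 // ltnS ltnW.
- move=> er /andP[v_lt f]; have [cd1 cd2] := code_at_cat cd.
  have [rg1 [ex1 v1 keep1]] := IH _ _ _ cd1 er f.
  exists (upd rg1 r (mm (eval rg mm e))); split=> [||y yr] //.
    rewrite !size_cat (exec_add _ ex1) /=.
    apply: exec_set v_lt _; last by rewrite !addnA addn1.
    by rewrite /step /= (code_at_onth cd2) v1.
  by rewrite upd_lt // keep1.
Qed.

(** * Statements and their compilation *)

Inductive stmt := Assign of nat & expr | Store of expr & expr.

Notation memory := ((nat -> nat) * (nat -> nat))%type.

Definition sem_stmt (st : memory) (c : stmt) : memory :=
  match c with
  | Assign x e => (upd st.1 x (eval st.1 st.2 e), st.2)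
  | Store ea ev => (st.1, upd st.2 (eval st.1 st.2 ea) (eval st.1 st.2 ev))
  end.

Definition sem (st : memory) (cs : seq stmt) : memory := foldl sem_stmt st cs.

(* Registers from [r] on serve as scratch space. *)
Definition compile_stmt (r : nat) (c : stmt) : program :=
  match c with
  | Assign x e => compile_expr e r ++ [:: Op Or x r r]
  | Store ea ev =>
      compile_expr ea r ++ compile_expr ev r.+1 ++ [:: Write r r.+1]
  end.

Definition compile (r : nat) (cs : seq stmt) : program :=
  flatten (map (compile_stmt r) cs).

Definition wf_stmt (r : nat) (wfe : pred expr) (c : stmt) : bool :=
  match c with
  | Assign x e => [&& x < r, regs_lt r e & wfe e]
  | Store ea ev => [&& regs_lt r ea, regs_lt r ev, wfe ea & wfe ev]
  end.

Fixpoint safe (good : memory -> Prop) (st : memory) (cs : seq stmt) : Prop :=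
  if cs is c :: cs' then good st /\ safe good (sem_stmt st c) cs' else True.

Lemma safe_cat good st cs1 cs2 :
  safe good st cs1 -> safe good (sem st cs1) cs2 -> safe good st (cs1 ++ cs2).
Proof. by elim: cs1 st => //= c cs IH st [g /IH H] /H. Qed.

Lemma sem_cat st cs1 cs2 : sem st (cs1 ++ cs2) = sem (sem st cs1) cs2.
Proof. exact: foldl_cat. Qed.

(** The semantics follows ideal registers [rg0], which the machine registers [rg] match only below
    [r], because compiled code also changes scratch registers. *)
Lemma compileP w Q r (wfe : pred expr) (good : memory -> Prop) cs p rg rg0 mm :
  (forall rg mm e, good (rg, mm) -> regs_lt r e -> wfe e -> fits w rg mm e) ->
  code_at Q p (compile r cs) -> all (wf_stmt r wfe) cs ->
  safe good (rg0, mm) cs -> (forall x, x < r -> rg x = rg0 x) ->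
  exists rg', exec w Q (size (compile r cs)) (State p rg mm) =
      Some (State (p + size (compile r cs)) rg' (sem (rg0, mm) cs).2) /\
    forall x, x < r -> rg' x = (sem (rg0, mm) cs).1 x.
Proof.
move=> goodP; elim: cs p rg rg0 mm => [|c cs IH] p rg rg0 mm.
  by move=> _ _ _ keep; exists rg; rewrite addn0.
rewrite /compile /= => /code_at_cat[cd cds] /andP[wf wfs] [g sf] keep.
suff [rg1 [ex1 keep1]] : exists rg1,
    exec w Q (size (compile_stmt r c)) (State p rg mm) =
      Some (State (p + size (compile_stmt r c)) rg1 (sem_stmt (rg0, mm) c).2) /\
    forall x, x < r -> rg1 x = (sem_stmt (rg0, mm) c).1 x.
  move: sf keep1; rewrite (surjective_pairing (sem_stmt (rg0, mm) c)) => sf keep1.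
  have [rg2 [ex2 keep2]] := IH _ _ _ _ cds wfs sf keep1.
  by exists rg2; rewrite size_cat (exec_add _ ex1) addnA; split.
case: c cd wf {sf cds} => [x e|ea ev] /= cd.
  case/and3P => xr er we; have [cd1 cd2] := code_at_cat cd.
  have f : fits w rg mm e by rewrite (fits_ext _ _ er keep); apply: goodP.
  have [rg1 [ex1 v1 keep1]] := compile_exprP cd1 er f.
  have v_lt : rg1 r < 2 ^ w by rewrite v1; case: (e) f => [?|?|? ? ?|?] /= /andP[].
  exists (upd rg1 x (rg1 r)); split.
    rewrite size_cat (exec_add _ ex1) /=; apply: exec_set v_lt _;
      last by rewrite !addnA addn1.
    by rewrite /step /= (code_at_onth cd2) /= PeanoNat.Nat.lor_diag.
  move=> y yr; rewrite /upd v1 (eval_ext mm er keep).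
  by case: ifP => // _; rewrite keep1 // keep.
case/and4P => ear evr wa wv; have [cd1 /code_at_cat[cd2 cd3]] := code_at_cat cd.
have fa : fits w rg mm ea by rewrite (fits_ext _ _ ear keep); apply: goodP.
have [rg1 [ex1 v1 keep1]] := compile_exprP cd1 ear fa.
have keep01 x : x < r -> rg1 x = rg0 x by move=> xr; rewrite keep1 // keep.
have fv : fits w rg1 mm ev by rewrite (fits_ext _ _ evr keep01); apply: goodP.
have [rg2 [ex2 v2 keep2]] := compile_exprP cd2 (regs_lt_leq (leqnSn r) evr) fv.
exists rg2; split; last by move=> y yr; rewrite keep2 ?keep01 // ltnS ltnW.
rewrite !size_cat (exec_add _ ex1) (exec_add _ ex2) exec1 /step /= (code_at_onth
  cd3) /=.
rewrite v2 keep2 // v1 (eval_ext mm ear keep) (eval_ext mm evr keep01).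
by rewrite !addnA addn1.
Qed.

(** * Bounds on intermediate values *)

Fixpoint weight (e : expr) : nat :=
  match e with
  | Reg _ => 1
  | Cst c => c.+1
  | Bin _ e1 e2 => weight e1 + weight e2
  | Fetch e => weight e
  end.

Fixpoint arith (e : expr) : bool :=
  match e with
  | Bin (Add | Defs.Sub | Mul | Div | Mod) e1 e2 => arith e1 && arith e2
  | Bin _ _ _ => false
  | Fetch e => arith e
  | _ => true
  end.

Definition bounded (B r : nat) (st : memory) : Prop :=
  (forall x, x < r -> st.1 x <= B) /\ forall x, st.2 x <= B.

Lemma weight_gt0 e : 0 < weight e.
Proof. by elim: e => //= o e1 H1 e2 H2; rewrite addn_gt0 H1. Qed.

(** For factors above 1 a sum is at most the product, so each of the five operations is bounded by
    the product of the bounds of its operands. *)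
Lemma eval_le B r rg mm e : 1 < B -> bounded B r (rg, mm) ->
  regs_lt r e -> arith e -> eval rg mm e <= B ^ weight e.
Proof.
move=> B1 [/= rgB mmB]; have B0 : 0 < B by apply: ltnW.
elim: e => [x|c|o e1 IH1 e2 IH2|e IH] /=.
- by move=> xr _; apply: rgB.
- by move=> _ _; apply: ltnW; apply: leq_trans (ltn_expl _ B1); rewrite ltnS.
- case/andP => /IH1{}IH1 /IH2{}IH2 A.
  have /andP[/IH1{}IH1 /IH2{}IH2] : arith e1 && arith e2 by case: (o) A.
  have pow w : 0 < w -> 1 < B ^ w.
    by move=> w0; rewrite -(expn0 B) ltn_exp2l.
  have [p1 p2] := (pow _ (weight_gt0 e1), pow _ (weight_gt0 e2)).
  rewrite expnD.
  have [leD leL] : B ^ weight e1 + B ^ weight e2 <= B ^ weight e1 * B ^ weight e2 /\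
      B ^ weight e1 <= B ^ weight e1 * B ^ weight e2 by split; nia.
  case: (o) A => //= _.
  - exact: leq_trans (leq_add IH1 IH2) leD.
  - exact: leq_trans (leq_subr _ _) (leq_trans IH1 leL).
  - exact: leq_mul.
  - exact: leq_trans (leq_div _ _) (leq_trans IH1 leL).
  - exact: leq_trans (leq_mod _ _) (leq_trans IH1 leL).
- move=> er ea; apply: leq_trans (mmB _) _.
  by rewrite -{1}(expn1 B) leq_exp2l // weight_gt0.
Qed.

Lemma fits_bounded B r w rg mm e : 1 < B -> bounded B r (rg, mm) ->
  regs_lt r e -> arith e -> B ^ weight e < 2 ^ w -> fits w rg mm e.
Proof.
move=> B1 bd.
have pow w1 w2 : w1 <= w2 -> B ^ w2 < 2 ^ w -> B ^ w1 < 2 ^ w.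
  by move=> ww; apply: leq_ltn_trans; rewrite leq_exp2l.
elim: e => [x|c|o e1 IH1 e2 IH2|e IH] er ea e_lt /=;
  rewrite (leq_ltn_trans (eval_le B1 bd er ea) e_lt) //=.
- case/andP: er => e1r e2r.
  have /andP[a1 a2] : arith e1 && arith e2 by case: (o) ea.
  by rewrite IH1 ?IH2 //; apply: pow e_lt; rewrite ?leq_addr ?leq_addl.
- exact: IH.
Qed.

End Machine.

(** * Relocating a program *)

Section Relocation.
Set Implicit Arguments.
Unset Strict Implicit.

Definition instr_regs_lt (r : nat) (i : instr) : bool :=
  match i with
  | Const x _ => x < r
  | Op _ x y z => [&& x < r, y < r & z < r]
  | Read x y | Write x y => (x < r) && (y < r)
  | JumpZ x _ => x < r
  | _ => true
  end.

(** Registers from [r] on are free for the surrounding program; register 0 stays with [P], as it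
    holds the answer. *)
Lemma instr_regs_bound (P : program) : exists r, 0 < r /\ all (instr_regs_lt r) P.
Proof.
elim: P => [|i P [r [r0 IH]]]; first by exists 1.
have mono r1 r2 j : r1 <= r2 -> instr_regs_lt r1 j -> instr_regs_lt r2 j.
  by case: j => //= *; lia.
have [r' i_lt] : exists r', instr_regs_lt r' i.
  case: i => [x c|o x y z|x y|x y|t|x t|] /=; try by exists x.+1.
  - by exists (x + y + z).+1; lia.
  - by exists (x + y).+1; lia.
  - by exists (x + y).+1; lia.
  - by exists 0.
  - by exists 0.
exists (maxn r r'); split; first by rewrite leq_max r0.
rewrite /= (mono _ _ _ (leq_maxr _ _) i_lt) /=.
by apply: sub_all IH => j; apply: mono; apply: leq_maxl.
Qed.

Lemma onth_nth_Some (T : Type) (s : seq T) p x :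
  onth s p = Some x -> p < size s /\ nth x s p = x.
Proof.
move=> E; have p_lt : p < size s by rewrite -onthTE E.
by move: E; rewrite onthE (nth_map x) // => -[->].
Qed.

Variables (base fin ro tmp : nat).

(* Every instruction becomes two, so that jump targets scale. *)
Definition relocate_instr (i : instr) : program :=
  match i with
  | Read x y => [:: Op Add tmp ro y; Read x tmp]
  | Write x y => [:: Op Add tmp ro x; Write tmp y]
  | Jump t => [:: Const tmp 0; Jump (base + 2 * t)]
  | JumpZ x t => [:: Const tmp 0; JumpZ x (base + 2 * t)]
  | Halt => [:: Const tmp 0; Jump fin]
  | _ => [:: Const tmp 0; i]
  end.

Definition relocate (P : program) : program := flatten (map relocate_instr P).

(** The answer true stands for the smaller diameter, hence for the absence of an orthogonal pair,
    and has to be flipped. *)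
Definition negate_answer : program :=
  [:: JumpZ 0 (fin + 3); Const 0 0; Halt; Const 0 1; Halt].

Lemma size_relocate P : size (relocate P) = 2 * size P.
Proof.
elim: P => //= i P IH; rewrite /relocate /= size_cat -/(relocate P) IH mulnS.
by case: i.
Qed.

Lemma relocate_code Q P p i : code_at Q base (relocate P) -> onth P p = Some i ->
  code_at Q (base + 2 * p) (relocate_instr i).
Proof.
move=> cd Pi; have [p_lt Pip] := onth_nth_Some Pi; move: cd.
rewrite -{1}(cat_take_drop p P) (drop_nth i p_lt) Pip.
rewrite /relocate map_cat flatten_cat -/(relocate _) => /code_at_cat[_].
rewrite size_relocate size_takel ?(ltnW p_lt) //.
by rewrite /= => /code_at_cat[].
Qed.

Variables (r : nat) (P Q : program) (w w' off : nat).
Hypotheses (r_gt0 : 0 < r) (r_ro : r <= ro) (r_tmp : r <= tmp) (ro_tmp : ro != tmp).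
Hypothesis P_regs : all (instr_regs_lt r) P.
Hypothesis Q_code : code_at Q base (relocate P).
Hypothesis Q_fin : code_at Q fin negate_answer.
Hypothesis ww' : 2 ^ w + off <= 2 ^ w'.

(** Simulation relation for a copy whose memory is shifted by [off]; the bound on registers makes
    shifted addresses fit in words of [w'] bits. *)
Definition relocated (s s' : state) : Prop :=
  [/\ pc s' = base + 2 * pc s, forall x, x < r -> reg s' x = reg s x,
      reg s' ro = off, forall x, Defs.mem s' (off + x) = Defs.mem s x
    & forall x, reg s x < 2 ^ w].

Lemma step_relocate s s1 s' i : onth P (pc s) = Some i -> i <> Halt ->
  step w P s = Some s1 -> relocated s s' ->
  exists2 s1', exec w' Q 2 s' = Some s1' & relocated s1 s1'.
Proof.
move=> Pi i_nh; case: s Pi => p rg mm /= Pi.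
have i_lt : instr_regs_lt r i.
  have [p_lt Pip] := onth_nth_Some Pi.
  by move/(all_nthP i): P_regs => /(_ p p_lt); rewrite Pip.
have Qi := relocate_code Q_code Pi.
rewrite /step Pi /set_reg /=.
case: s' => p' rg' mm' st [/= -> rgE roE mmE rg_lt].
have lt_w' v : v < 2 ^ w -> v < 2 ^ w'.
  by move=> v_lt; apply: leq_trans ww'; apply: leq_trans v_lt (leq_addr _ _).
have lt_w'0 : 0 < 2 ^ w' by rewrite expn_gt0.
have upd_tmp v x : x < r -> upd rg' tmp v x = rg x.
  move=> xr; rewrite /upd; case: eqP => [E|_]; last exact: rgE.
  by move: r_tmp; rewrite -E leqNgt xr.
have ro_upd v : upd rg' tmp v ro = off by rewrite /upd (negPf ro_tmp).
have upd2 v u x y : x < r -> y < r -> upd (upd rg' tmp v) x u y = upd rg x u y.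
  by move=> xr yr; rewrite {1 3}/upd; case: eqP => // _; apply: upd_tmp.
have ro_upd2 v u x : x < r -> upd (upd rg' tmp v) x u ro = off.
  move=> xr; rewrite {1}/upd; case: eqP => [E|_]; last exact: ro_upd.
  by move: r_ro; rewrite E leqNgt xr.
have pcE : base + 2 * p.+1 = (base + 2 * p).+2 by rewrite mulnS; lia.
have setR u x v : x < r -> v < 2 ^ w -> relocated (State p.+1 (upd rg x v) mm)
    (State (base + 2 * p).+2 (upd (upd rg' tmp u) x v) mm').
  move=> xr v_lt; split=> //= [a ar||a]; [exact: upd2 | exact: ro_upd2 |].
  by rewrite /upd; case: ifP.
have jumpR u p1 : relocated (State p1 rg mm) (State (base + 2 * p1) (upd rg' tmp u)
  mm').
  by split=> //= a ar; apply: upd_tmp.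
have first_const rest : code_at Q (base + 2 * p) (Const tmp 0 :: rest) ->
    step w' Q (State (base + 2 * p) rg' mm') =
      Some (State (base + 2 * p).+1 (upd rg' tmp 0) mm').
  by move=> cd; rewrite /step /= (code_at_onth cd) /set_reg lt_w'0.
have first_add x rest : x < r ->
    code_at Q (base + 2 * p) (Op Add tmp ro x :: rest) ->
    step w' Q (State (base + 2 * p) rg' mm') =
      Some (State (base + 2 * p).+1 (upd rg' tmp (off + rg x)) mm').
  move=> xr cd; rewrite /step /= (code_at_onth cd) /set_reg /= roE rgE //.
  have -> // : off + rg x < 2 ^ w'.
  by apply: leq_trans ww'; rewrite addnC ltn_add2r.
have second k : code_at Q (base + 2 * p) k -> forall j, k = [:: head Halt k; j] ->
    onth Q (base + 2 * p).+1 = Some j.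
  by move=> cd j E; move: cd; rewrite E => /code_at_cons /code_at_onth.
have sec := second _ Qi.
case: i i_nh i_lt {Pi} Qi sec st => [x c|o x y z|x y|x y|t|x t|] //= _ xr Qi sec.
- case: ifP => // c_lt [<-]; rewrite execS (first_const _ Qi) /=.
  rewrite exec1 /step /= (sec _ erefl) /set_reg lt_w' //.
  by eexists; [by [] | exact: setR].
- case/and3P: xr => xr yr zr; case: ifP => // c_lt [<-].
  rewrite execS (first_const _ Qi) /= exec1 /step /= (sec _ erefl) /set_reg.
  rewrite !upd_tmp // lt_w' //.
  by eexists; [by [] | exact: setR].
- case/andP: xr => xr yr; case: ifP => // c_lt [<-].
  rewrite execS (first_add y _ yr Qi) /= exec1 /step /= (sec _ erefl) /set_reg /=.
  have -> : upd rg' tmp (off + rg y) tmp = off + rg y by rewrite /upd eqxx.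
  rewrite mmE lt_w' //.
  by eexists; [by [] | exact: setR].
- case/andP: xr => xr yr [<-].
  rewrite execS (first_add x _ xr Qi) /= exec1 /step /= (sec _ erefl).
  have -> : upd rg' tmp (off + rg x) tmp = off + rg x by rewrite /upd eqxx.
  rewrite upd_tmp //; eexists; first by [].
  split=> //= [a ar|a]; first exact: upd_tmp.
  by rewrite /upd eqn_add2l; case: eqP.
- move=> [<-]; rewrite execS (first_const _ Qi) /= exec1 /step /= (sec _ erefl).
  by eexists; [by [] | exact: jumpR].
- move=> [<-]; rewrite execS (first_const _ Qi) /= exec1 /step /= (sec _ erefl).
  eexists; first by []; rewrite /= upd_tmp //.
  have -> : (if rg x == 0 then base + 2 * t else (base + 2 * p).+2) =
    base + 2 * (if rg x == 0 then t else p.+1) by case: ifP.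
  exact: jumpR.
Qed.

(** The factor 2 is the length of a relocated instruction; the step count is only bounded, since
    idle steps at [Halt] have no counterpart. *)
Lemma exec_relocate t s s2 s' : exec w P t s = Some s2 ->
  onth P (pc s2) = Some Halt -> relocated s s' ->
  exists t' s2', [/\ t' <= 2 * t, exec w' Q t' s' = Some s2' & relocated s2 s2'].
Proof.
elim: t s s' => [|t IH] s s'.
  by move=> [<-] _ R; exists 0, s'.
rewrite execS => + halt R; case st: (step w P s) => [s1|] //= ex.
case Pi : (onth P (pc s)) st => [i|]; last by rewrite /step Pi.
have [iH|i_nh] : i = Halt \/ i <> Halt by case: (i); auto; right.
  rewrite /step Pi iH => -[E]; rewrite -E in ex.
  have [t' [s2' [tt ex' R']]] := IH _ _ ex halt R.
  by exists t', s2'; split=> //; lia.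
move=> st; have [s1' ex1 R1] := step_relocate Pi i_nh st R.
have [t' [s2' [tt ex' R']]] := IH _ _ ex halt R1.
by exists (2 + t'), s2'; rewrite (exec_add _ ex1); split=> //; lia.
Qed.

(** Two steps leave the relocated [Halt], two more test register 0 and overwrite it. *)
Lemma exec_negate s s' : relocated s s' -> onth P (pc s) = Some Halt -> 0 < w' ->
  exists s2, [/\ exec w' Q 4 s' = Some s2, onth Q (pc s2) = Some Halt
    & (reg s2 0 != 0) = ~~ (reg s 0 != 0)].
Proof.
move=> [pcE rgE _ _ _] /(relocate_code Q_code) /= cd w'0.
case: s' pcE rgE => p' rg' mm' /= -> rgE.
have lt1 : 1 < 2 ^ w' by rewrite -(expn0 2) ltn_exp2l.
rewrite execS /step /= (code_at_onth cd) /set_reg (ltnW lt1) /=.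
rewrite execS /step /= (code_at_onth (code_at_cons cd)) /=.
rewrite execS /step /= (code_at_onth Q_fin) /=.
have tmp0 : (0 == tmp) = false by lia.
rewrite {1}/upd tmp0 rgE //.
have F1 := code_at_cons Q_fin; have F2 := code_at_cons F1.
have F3 := code_at_cons F2; have F4 := code_at_cons F3.
case: ifP => s0.
  rewrite exec1 /step /= addn3 (code_at_onth F3) /set_reg lt1.
  by eexists; split; [by [] | exact: code_at_onth F4 | by []].
rewrite exec1 /step /= (code_at_onth F1) /set_reg (ltnW lt1).
by eexists; split; [by [] | exact: code_at_onth F2 | by []].
Qed.

End Relocation.

(** * Printing a list of edges and running a program on it *)

Section Printer.
Set Implicit Arguments.
Unset Strict Implicit.

Notation memory := ((nat -> nat) * (nat -> nat))%type.

Variables (I : eqType) (r0 : nat) (J : seq I) (ce ue ve : I -> expr) (eN eT : expr).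
Variable P : program.

(* The registers [r0], ..., [r0 + 5] hold n, d, the loop counter, the address of
   the first free cell, the start of the output and the number of remaining
   iterations. *)
Definition header : seq stmt :=
  [:: Assign (r0 + 0) (Fetch (Cst 0)); Assign (r0 + 1) (Fetch (Cst 1));
      Assign (r0 + 4)
        (Bin Add (Cst 2) (Bin Mul (Cst 2) (Bin Mul (Reg (r0 + 0)) (Reg (r0 + 1)))));
      Store (Reg (r0 + 4)) eN;
      Assign (r0 + 3) (Bin Add (Reg (r0 + 4)) (Cst 2)); Assign (r0 + 2) (Cst 0)].

Definition loop_test : seq stmt :=
  [:: Assign (r0 + 5) (Bin Defs.Sub eT (Reg (r0 + 2)))].

(* Branch-free conditional output: when the condition is 0, two zeros are
   written to free cells, which contain 0 anyway, and the pointer stays. *)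
Definition print_entry (j : I) : seq stmt :=
  [:: Store (Reg (r0 + 3)) (Bin Mul (ce j) (ue j));
      Store (Bin Add (Reg (r0 + 3)) (Cst 1)) (Bin Mul (ce j) (ve j));
      Assign (r0 + 3) (Bin Add (Reg (r0 + 3)) (Bin Mul (Cst 2) (ce j)))].

Definition loop_body : seq stmt :=
  flatten (map print_entry J) ++
  [:: Assign (r0 + 2) (Bin Add (Reg (r0 + 2)) (Cst 1))].

(** The number of edges is known only after the loop; it is half the distance travelled by the
    output pointer. *)
Definition footer : seq stmt :=
  [:: Store (Bin Add (Reg (r0 + 4)) (Cst 1))
        (Bin Div (Bin Defs.Sub (Reg (r0 + 3)) (Bin Add (Reg (r0 + 4)) (Cst 2)))
          (Cst 2))].

Definition code_of (cs : seq stmt) : program := compile (r0 + 6) cs.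

Arguments code_of : simpl never.

Definition loop_start : nat := size (code_of header).
Definition loop_cost : nat :=
  size (code_of loop_test) + 1 + size (code_of loop_body) + 1.
Definition loop_end : nat := loop_start + loop_cost.
Definition payload_start : nat := loop_end + size (code_of footer).
Definition payload_end : nat := payload_start + 2 * size P.

Definition print_and_run : program :=
  code_of header ++ code_of loop_test ++ [:: JumpZ (r0 + 5) loop_end] ++
  code_of loop_body ++ [:: Jump loop_start] ++ code_of footer ++
  relocate payload_start payload_end (r0 + 4) (r0 + 6) P ++ negate_answer payload_end.

Variables (inp : seq nat) (n d N T : nat) (act : I -> nat -> bool) (us vs : I ->
  nat -> nat).
Hypotheses (inp0 : nth 0 inp 0 = n) (inp1 : nth 0 inp 1 = d).
Hypothesis size_inp : size inp = 2 + 2 * (n * d).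

(** All that the expressions of the loop may rely on; output is written behind the input and does
    not disturb it. *)
Definition agree (t : nat) (st : memory) : Prop :=
  [/\ st.1 (r0 + 0) = n, st.1 (r0 + 1) = d, st.1 (r0 + 2) = t
    & forall x, x < size inp -> st.2 x = nth 0 inp x].

Hypothesis eNP : forall st, agree 0 st -> eval st.1 st.2 eN = N.
Hypothesis eTP : forall t st, agree t st -> eval st.1 st.2 eT = T.
Hypothesis ceP : forall j t st, j \in J -> t < T -> agree t st ->
  eval st.1 st.2 (ce j) = act j t.
Hypothesis ueP : forall j t st, j \in J -> t < T -> agree t st -> act j t ->
  eval st.1 st.2 (ue j) = us j t.
Hypothesis veP : forall j t st, j \in J -> t < T -> agree t st -> act j t ->
  eval st.1 st.2 (ve j) = vs j t.

Variables (w B W : nat).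
Hypotheses (B_gt1 : 1 < B) (BW : B ^ W < 2 ^ w).
Hypothesis inp_le : forall x, nth 0 inp x <= B.
Hypotheses (N_le : N <= B) (T_le : T <= B).
Hypothesis us_le : forall j t, j \in J -> t < T -> act j t -> us j t <= B.
Hypothesis vs_le : forall j t, j \in J -> t < T -> act j t -> vs j t <= B.
Hypothesis size_le : size inp + 2 + 2 * (T * size J) <= B.

Definition light (e : expr) : bool := arith e && (weight e <= W).

Hypothesis wf : all (wf_stmt (r0 + 6) light) (header ++ loop_test ++ loop_body ++
  footer).

Definition out_row (t : nat) (js : seq I) : seq (nat * nat) :=
  [seq (us j t, vs j t) | j <- js & act j t].

Definition out (t : nat) : seq (nat * nat) :=
  flatten [seq out_row i J | i <- iota 0 t].

Definition flat (s : seq (nat * nat)) : seq nat :=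
  flatten [seq [:: p.1; p.2] | p <- s].

(** The 0 after [N] is a placeholder that [footer] overwrites with the number of edges. *)
Definition printed (t : nat) (s : seq (nat * nat)) (st : memory) : Prop :=
  [/\ agree t st, st.1 (r0 + 3) = size inp + 2 + 2 * size s, st.1 (r0 + 4) = size inp,
      forall x, x < r0 -> st.1 x = 0
    & st.2 =1 nth 0 (inp ++ [:: N, 0 & flat s])].

Let ok := bounded B (r0 + 6).

(** * Correctness of the printing loop *)

Lemma size_flat s : size (flat s) = 2 * size s.
Proof. by rewrite /flat; elim: s => //= p s ->; rewrite mulnS. Qed.

Lemma size_out_row t js : size (out_row t js) <= size js.
Proof. by rewrite size_map size_filter count_size. Qed.

Lemma size_out t : size (out t) <= t * size J.
Proof.
rewrite /out; elim: t => // t IH.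
rewrite -{1}addn1 iotaD map_cat flatten_cat size_cat /= cats0 mulSn addnC.
by apply: leq_add IH; apply: size_out_row.
Qed.

Lemma outS t : out t.+1 = out t ++ out_row t J.
Proof. by rewrite /out -addn1 iotaD map_cat flatten_cat /= cats0. Qed.

Lemma upd_nth_rcons f l p v :
  f =1 nth 0 l -> size l = p -> upd f p v =1 nth 0 (rcons l v).
Proof.
by move=> fE <- x; rewrite /upd nth_rcons fE; case: ltngtP => // ?;
  rewrite nth_default // ltnW.
Qed.

(** Cells behind the list read as the default 0, so storing 0 there changes nothing; this covers
    inactive entries. *)
Lemma upd_nth0 f l p : f =1 nth 0 l -> size l <= p -> upd f p 0 =1 nth 0 l.
Proof.
by move=> fE lp x; rewrite /upd fE; case: eqP => // ->; rewrite nth_default.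
Qed.

Lemma bounded_store st ea ev : ok st -> eval st.1 st.2 ev <= B ->
  ok (sem_stmt st (Store ea ev)).
Proof.
by move=> [okr okm] v_le; split=> // x; rewrite /= /upd; case: ifP.
Qed.

Lemma bounded_assign st x e : ok st -> eval st.1 st.2 e <= B ->
  ok (sem_stmt st (Assign x e)).
Proof.
by move=> [okr okm] v_le; split=> // y y_lt; rewrite /= /upd; case: ifP => // _;
  apply: okr.
Qed.

Lemma upd_other f i j v : i != j -> upd f (r0 + i) v (r0 + j) = f (r0 + j).
Proof. by rewrite /upd eqn_add2l eq_sym => /negPf->. Qed.

Lemma upd_same f i v : upd f i v i = v.
Proof. by rewrite /upd eqxx. Qed.

Lemma upd_low f i v x : x < r0 -> upd f (r0 + i) v x = f x.
Proof. by rewrite /upd; case: eqP => // ->; rewrite ltnNge leq_addr. Qed.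

Lemma agree_store t st p v : size inp <= p -> agree t st ->
  agree t (st.1, upd st.2 p v).
Proof.
move=> p_ge [nE dE tE mE]; split=> //= x x_lt; rewrite /upd.
by case: eqP => [E|_]; [move: x_lt; rewrite E ltnNge p_ge | apply: mE].
Qed.

Lemma print_entryP j t s st : j \in J -> t < T -> printed t s st -> ok st ->
  size inp + 2 + 2 * (size s).+1 <= B ->
  let st' := sem st (print_entry j) in
  [/\ safe ok st (print_entry j), printed t (s ++ out_row t [:: j]) st' & ok st'].
Proof.
move=> jJ t_lt pr okst sz; have [ag pE oE low mE] := pr.
set p := size inp + 2 + 2 * size s in pE.
have cE := ceP jJ t_lt ag; have p_ge : size inp <= p by rewrite /p -addnA leq_addr.
(* [u] and [v] are the values stored; for an inactive entry they are 0 whatever [ue j] and [ve j]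
   evaluate to. *)
pose u := act j t * eval st.1 st.2 (ue j).
have u_le : u <= B.
  by rewrite /u; case a : (act j t); rewrite // mul1n (ueP jJ t_lt ag) ?us_le.
set st1 := (st.1, upd st.2 p u).
have ag1 : agree t st1 by apply: agree_store.
pose v := act j t * eval st1.1 st1.2 (ve j).
have v_le : v <= B.
  by rewrite /v; case a : (act j t); rewrite // mul1n (veP jJ t_lt ag1) ?vs_le.
set st2 := (st.1, upd st1.2 (p + 1) v).
have ag2 : agree t st2 by apply: (agree_store (st := st1)) => //; lia.
set st3 := (upd st.1 (r0 + 3) (p + 2 * act j t), st2.2).
have E1 : sem_stmt st (Store (Reg (r0 + 3)) (Bin Mul (ce j) (ue j))) = st1.
  by rewrite /= cE pE.
have E2 : sem_stmt st1 (Store (Bin Add (Reg (r0 + 3)) (Cst 1)) (Bin Mul (ce j) (ve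
  j))) = st2.
  by rewrite /= pE (ceP jJ t_lt ag1).
have E3 : sem_stmt st2 (Assign (r0 + 3)
    (Bin Add (Reg (r0 + 3)) (Bin Mul (Cst 2) (ce j)))) = st3.
  by rewrite /= pE (ceP jJ t_lt ag2).
have ok1 : ok st1 by rewrite -E1; apply: bounded_store; rewrite //= cE.
have ok2 : ok st2 by rewrite -E2; apply: bounded_store; rewrite //= (ceP jJ t_lt ag1).
have ok3 : ok st3.
  rewrite -E3; apply: bounded_assign => //=; rewrite pE (ceP jJ t_lt ag2) /p.
  by case: (act j t); lia.
have semE : sem st (print_entry j) = st3.
  have semS st0 c cs : sem st0 (c :: cs) = sem (sem_stmt st0 c) cs by [].
  by rewrite /print_entry !semS E1 E2 E3.
rewrite semE; split=> //.
  have safeS st0 c cs : ok st0 -> safe ok (sem_stmt st0 c) cs ->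
    safe ok st0 (c :: cs).
    by split.
  by rewrite /print_entry; apply: (safeS st) => //; rewrite E1;
    apply: (safeS st1) => //; rewrite E2; split.
rewrite /out_row /=; split.
- by case: ag2 => nE dE tE mE2; split=> //=; rewrite upd_other.
- by rewrite /= upd_same /p size_cat; case: (act j t) => /=; lia.
- by rewrite /= upd_other.
- by move=> x xr; rewrite /= upd_low ?low.
rewrite /= /v /u; case: (act j t) (ueP jJ t_lt ag) (veP jJ t_lt ag1) =>
  [uE vE|_ _]; last first.
  rewrite !mul0n cats0.
  have sz_le : size (inp ++ [:: N, 0 & flat s]) <= p.
    by rewrite size_cat /= size_flat /p; lia.
  by apply: upd_nth0; [apply: upd_nth0 | lia].
rewrite !mul1n uE // vE //= => x.
have -> : inp ++ [:: N, 0 & flat (s ++ [:: (us j t, vs j t)])] =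
    rcons (rcons (inp ++ [:: N, 0 & flat s]) (us j t)) (vs j t).
  by rewrite /flat map_cat flatten_cat /= -!cats1 -!catA.
apply: upd_nth_rcons; first apply: upd_nth_rcons => //.
  by rewrite size_cat /= size_flat /p; lia.
by rewrite size_rcons size_cat /= size_flat /p; lia.
Qed.

Lemma print_entriesP js t s st : {subset js <= J} -> t < T -> printed t s st ->
  ok st ->
  size inp + 2 + 2 * (size s + size js) <= B ->
  [/\ safe ok st (flatten (map print_entry js)),
      printed t (s ++ out_row t js) (sem st (flatten (map print_entry js)))
    & ok (sem st (flatten (map print_entry js)))].
Proof.
elim: js s st => [|j js IH] s st sub t_lt pr okst sz.
  by split; rewrite // cats0.
have jJ : j \in J by apply: sub; rewrite mem_head.
have [|sf1 pr1 ok1] := print_entryP jJ t_lt pr okst; first by move: sz => /=; lia.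
have sub' : {subset js <= J} by move=> x xjs; apply: sub; rewrite inE xjs orbT.
have [|sf2 pr2 ok2] := IH _ _ sub' t_lt pr1 ok1.
  have := size_out_row t [:: j]; rewrite size_cat; move: sz => /=; lia.
have -> : flatten (map print_entry (j :: js)) =
    print_entry j ++ flatten (map print_entry js) by [].
rewrite sem_cat; split=> //; first exact: safe_cat.
by move: pr2; rewrite -catA /out_row -map_cat -filter_cat cat1s.
Qed.

Lemma loop_bodyP t st : t < T -> printed t (out t) st -> ok st ->
  [/\ safe ok st loop_body, printed t.+1 (out t.+1) (sem st loop_body)
    & ok (sem st loop_body)].
Proof.
move=> t_lt pr okst; have sub : {subset J <= J} by [].
have [|sf1 pr1 ok1] := print_entriesP sub t_lt pr okst.
  by have := size_out t; nia.
rewrite /loop_body sem_cat; set st1 := sem st _ in pr1 ok1 *.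
move: pr1; rewrite -outS => -[[nE dE tE mE] pE oE low memE].
split; first by apply: safe_cat sf1 _; split.
  split=> //=; rewrite ?upd_other //; last by move=> x xr; rewrite upd_low ?low.
  split; [by rewrite /= upd_other | by rewrite /= upd_other | | exact: mE].
  by rewrite /= upd_same tE addn1.
by apply: bounded_assign => //=; rewrite tE addn1; apply: leq_trans t_lt T_le.
Qed.

Lemma headerP st : st.2 =1 nth 0 inp -> (forall x, st.1 x = 0) ->
  [/\ safe ok st header, printed 0 [::] (sem st header) & ok (sem st header)].
Proof.
move=> mE rE; rewrite /header.
have semS st0 c cs : sem st0 (c :: cs) = sem (sem_stmt st0 c) cs by [].
have sem0 st0 : sem st0 [::] = st0 by [].
have safeS st0 c cs : ok st0 -> safe ok (sem_stmt st0 c) cs -> safe ok st0 (c :: cs).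
  by split.
rewrite !semS sem0; set st1 := sem_stmt st _.
have e1 : st1 = (upd st.1 (r0 + 0) n, st.2).
  by rewrite /st1 /= mE inp0.
have ok0 : ok st by split=> x *; rewrite ?rE ?mE.
have ok1 : ok st1 by apply: bounded_assign => //=; rewrite mE.
move: (erefl st1); rewrite {1}/st1 => S1; clearbody st1; set st2 := sem_stmt st1 _;
  have e2 : st2 = (upd st1.1 (r0 + 1) d, st.2).
  by rewrite /st2 e1 /= mE inp1.
have ok2 : ok st2 by apply: bounded_assign => //; rewrite e1 /= mE.
move: (erefl st2); rewrite {1}/st2 => S2; clearbody st2.
have sizeE : eval st2.1 st2.2 (Bin Add (Cst 2) (Bin Mul (Cst 2)
    (Bin Mul (Reg (r0 + 0)) (Reg (r0 + 1))))) = size inp.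
  by rewrite e2 e1 /= /upd !eqn_add2l size_inp.
set st3 := sem_stmt st2 _; have e3 : st3 = (upd st2.1 (r0 + 4) (size inp), st.2).
  by rewrite /st3 -sizeE e2.
have ok3 : ok st3.
  apply: bounded_assign => //; rewrite sizeE; move: size_le; lia.
move: (erefl st3); rewrite {1}/st3 => S3; clearbody st3.
have ag3 p v : size inp <= p -> agree 0 (st3.1, upd st.2 p v).
  move=> p_ge; apply: (agree_store (st := (st3.1, st.2))) => //.
  by rewrite e3 e2 e1; split=> /= [|||x _]; rewrite ?mE // /upd !eqn_add2l /= ?rE.
have ag3' : agree 0 st3.
  have [a1 a2 a3 _] := ag3 (size inp) 0 (leqnn _).
  by split=> // x _; rewrite e3 /= mE.
set st4 := sem_stmt st3 _; have e4 : st4 = (st3.1, upd st.2 (size inp) N).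
  by rewrite /st4 /= (eNP ag3') e3 /= upd_same.
have ok4 : ok st4 by apply: bounded_store => //; rewrite (eNP ag3').
move: (erefl st4); rewrite {1}/st4 => S4; clearbody st4; set st5 := sem_stmt st4 _.
have e5 : st5 = (upd st3.1 (r0 + 3) (size inp + 2), st4.2).
  by rewrite /st5 e4 e3 /= upd_same.
have ok5 : ok st5.
  apply: bounded_assign => //; rewrite e4 e3 /= upd_same.
  by move: size_le; lia.
move: (erefl st5); rewrite {1}/st5 => S5; clearbody st5; set st6 := sem_stmt st5 _;
  have e6 : st6 = (upd st5.1 (r0 + 2) 0, st4.2).
  by rewrite /st6 e5.
have ok6 : ok st6 by apply: bounded_assign.
move: (erefl st6); rewrite {1}/st6 => S6; clearbody st6.
split=> //.
  apply: (safeS st) => //; rewrite S1; apply: (safeS st1) => //; rewrite S2.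
  apply: (safeS st2) => //; rewrite S3; apply: (safeS st3) => //; rewrite S4.
  by apply: (safeS st4) => //; rewrite S5; apply: (safeS st5).
rewrite e6 e5 e4 e3 e2 e1; have [a1 a2 a3 a4] := ag3 (size inp) N (leqnn _).
split.
- by rewrite e3 e2 e1 in a1 a2 a4; split=> //=;
    rewrite /upd !eqn_add2l /= ?inp0 ?inp1.
- by rewrite /= /upd !eqn_add2l /= muln0 addn0.
- by rewrite /= /upd !eqn_add2l.
- by move=> x xr; rewrite /= !upd_low.
have -> : inp ++ [:: N, 0 & flat [::]] = rcons (rcons inp N) 0.
  by rewrite -!cats1 -catA.
move=> x; rewrite nth_rcons_default /=; exact: upd_nth_rcons.
Qed.

Lemma footerP s st : printed T s st -> ok st -> size s <= T * size J ->
  safe ok st footer /\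
  (sem st footer).2 =1 nth 0 (inp ++ [:: N, size s & flat s]) /\
  (sem st footer).1 = st.1.
Proof.
move=> [ag pE oE low mE] okst sz; split; first by [].
split=> // x; rewrite /= oE pE.
have -> : (size inp + 2 + 2 * size s - (size inp + 2)) %/ 2 = size s.
  by rewrite addKn mulKn.
rewrite /upd mE !nth_cat; case: eqP => [->|x_ne].
  by rewrite addn1 ltnNge leqnSn /= subSnn.
case: ltnP => // x_ge; case: (x - size inp) (subnK x_ge) => [|[|k]] //= H.
by case: x_ne; rewrite -H addnC.
Qed.

(** * Running the whole program *)

Hypothesis r0_gt0 : 0 < r0.
Hypothesis P_regs : all (instr_regs_lt r0) P.
Variable w0 : nat.
Hypothesis w0w : 2 ^ w0 + size inp <= 2 ^ w.

Let Q := print_and_run.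

Lemma light_fits rg mm e : ok (rg, mm) -> regs_lt (r0 + 6) e -> light e ->
  fits w rg mm e.
Proof.
move=> okst er /andP[ea eW]; apply: (fits_bounded B_gt1 okst) => //.
by apply: leq_ltn_trans BW; rewrite leq_exp2l.
Qed.

Lemma print_and_run_code :
  [/\ code_at Q 0 (code_of header),
      code_at Q loop_start (code_of loop_test ++ [:: JumpZ (r0 + 5) loop_end] ++
        code_of loop_body ++ [:: Jump loop_start]),
      code_at Q loop_end (code_of footer),
      code_at Q payload_start (relocate payload_start payload_end (r0 + 4) (r0 + 6) P)
    & code_at Q payload_end (negate_answer payload_end)].
Proof.
have : code_at Q 0 Q by exists [::], [::]; rewrite cats0.
rewrite {2}/Q /print_and_run => /code_at_cat[c1].
rewrite add0n -/loop_start.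
have -> (c2 c3 c4 c5 c6 : program) :
  c2 ++ c3 ++ c4 ++ c5 ++ c6 = (c2 ++ c3 ++ c4 ++ c5) ++ c6.
  by rewrite !catA.
move=> /code_at_cat[c2].
have -> : loop_start + size (code_of loop_test ++ [:: JumpZ (r0 + 5) loop_end] ++
    code_of loop_body ++ [:: Jump loop_start]) = loop_end.
  by rewrite /loop_end /loop_cost !size_cat !addnA.
move=> /code_at_cat[c3 /code_at_cat[c4]]; rewrite size_relocate => c5.
by split.
Qed.

Lemma wf_parts : [/\ all (wf_stmt (r0 + 6) light) header,
  all (wf_stmt (r0 + 6) light) loop_test, all (wf_stmt (r0 + 6) light) loop_body
  & all (wf_stmt (r0 + 6) light) footer].
Proof.
move: wf; rewrite all_cat => /andP[? ]; rewrite all_cat => /andP[? ].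
by rewrite all_cat => /andP[].
Qed.

(** Induction on the number [m] of remaining rounds; the last test, which leaves the loop, is
    counted separately. *)
Lemma loop_run m t rg rg0 mm : t + m = T -> printed t (out t) (rg0, mm) ->
  ok (rg0, mm) -> (forall x, x < r0 + 6 -> rg x = rg0 x) ->
  exists rg' rg0' mm',
    [/\ exec w Q (m * loop_cost + (size (code_of loop_test) + 1)) (State loop_start
      rg mm) =
          Some (State loop_end rg' mm'),
        printed T (out T) (rg0', mm'), ok (rg0', mm')
      & forall x, x < r0 + 6 -> rg' x = rg0' x].
Proof.
have [_ cd _ _ _] := print_and_run_code.
have [cd1 /code_at_cat[cd2 /code_at_cat[cd3 cd4]]] := code_at_cat cd.
rewrite [size [:: JumpZ _ _]]/= addn1 in cd3 cd4.
have [_ wf_test wf_body _] := wf_parts.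
elim: m t rg rg0 mm => [|m IH] t rg rg0 mm tm pr okst keep.
all: have [ag /= pE oE low mE] := pr; have [/= nE dE tE inpE] := ag.
all: have okt : ok (sem (rg0, mm) loop_test) by
  (apply: bounded_assign => //=; rewrite (eTP ag) /= tE;
    apply: leq_trans (leq_subr _ _) T_le).
all: have [|rg1 [ex1 keep1]] := compileP light_fits cd1 wf_test (rg0 := rg0) (mm :=
  mm) _ keep;
  first by split.
all: have prt : printed t (out t) (sem (rg0, mm) loop_test)
  by (split=> //=; [split=> //=; rewrite upd_other | rewrite upd_other
      | rewrite upd_other | move=> x xr; rewrite upd_low ?low]).
all: have memE : (sem (rg0, mm) loop_test).2 = mm by [].
all: rewrite (surjective_pairing (sem (rg0, mm) loop_test)) memE in prt okt.
all: have cntE : rg1 (r0 + 5) = T - t by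
  (rewrite keep1 ?ltn_add2l //= upd_same (eTP ag) /= tE).
- rewrite addn0 in tm; rewrite tm in prt cntE.
  exists rg1, (sem (rg0, mm) loop_test).1, mm;
    rewrite mul0n add0n (exec_add _ ex1) exec1.
  rewrite /step (code_at_onth cd2) /= cntE subnn /=; split;
    [by [] | exact: prt | exact: okt | exact: keep1].
have t_lt : t < T by rewrite -tm addnS ltnS leq_addr.
have [sfb prb okb] := loop_bodyP t_lt prt okt.
have [rg2 [ex2 keep2]] := compileP light_fits cd3 wf_body sfb keep1.
move: prb okb keep2 ex2; set st2 := sem _ loop_body => prb okb keep2 ex2.
rewrite (surjective_pairing st2) in prb okb.
have [|rg' [rg0' [mm' [ex' pr' ok' keep']]]] :=
  IH t.+1 rg2 st2.1 st2.2 _ prb okb keep2.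
  by rewrite addSnnS.
exists rg', rg0', mm'; split=> //; rewrite mulSn {1}/loop_cost.
rewrite -!addnA (exec_add _ ex1) execS /step (code_at_onth cd2) /= cntE.
rewrite subn_eq0 leqNgt t_lt /=.
rewrite (exec_add _ ex2) execS /step.
by rewrite (code_at_onth cd4) /= -ex' addnA.
Qed.

Lemma print_and_runP t s ans :
  exec w0 P t (init [:: N, size (out T) & flat (out T)]) = Some s ->
  onth P (pc s) = Some Halt -> (reg s 0 != 0) = ans ->
  exists t' s', [/\ t' <= loop_start + loop_cost * T + loop_cost + size (code_of
    footer) + 2 * t + 4,
    exec w Q t' (init inp) = Some s', onth Q (pc s') = Some Halt
    & (reg s' 0 != 0) = ~~ ans].
Proof.
move=> exP halt <-; have [cd1 cd2 cd3 cd4 cd5] := print_and_run_code.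
have [wf_header _ _ wf_footer] := wf_parts.
have [||sfh prh okh] := @headerP (reg (init inp), Defs.mem (init inp));
  [by [] | by [] |].
have [//|rg1 [ex1 keep1]] := compileP light_fits cd1 wf_header sfh (rg := fun=> 0).
rewrite (surjective_pairing (sem _ header)) in prh okh.
have [//|rg2 [rg0 [mm2 [ex2 pr2 ok2 keep2]]]] := loop_run (m := T) _ prh okh keep1.
have [sff [memF regF]] := footerP pr2 ok2 (size_out T).
have [rg3 [ex3 keep3]] := compileP light_fits cd3 wf_footer sff keep2.
set mm3 := (sem _ footer).2 in memF ex3.
(* The output starts at address [size inp], so shifting by it yields the initial memory of [P]; the
   registers below [r0] are still 0. *)
have R : relocated payload_start (r0 + 4) r0 w0 (size inp)
    (init [:: N, size (out T) & flat (out T)]) (State payload_start rg3 mm3).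
  have [_ _ oE low _] := pr2.
  split=> //= [|x xr||x|_]; rewrite ?muln0 ?addn0 ?expn_gt0 //.
  - by rewrite keep3 ?regF ?ltn_addr //; apply: low.
  - by rewrite keep3 ?regF ?ltn_add2l.
  - by rewrite memF nth_cat ltnNge leq_addr addKn.
have r04 : r0 <= r0 + 4 := leq_addr _ _.
have r06 : r0 <= r0 + 6 := leq_addr _ _.
have r046 : r0 + 4 != r0 + 6 by rewrite eqn_add2l.
have [t' [s2 [tt ex4 R2]]] :=
  exec_relocate r0_gt0 r04 r06 r046 P_regs cd4 w0w exP halt R.
have [|s3 [ex5 halt3 ans3]] :=
  exec_negate r0_gt0 r04 r06 r046 P_regs cd4 cd5 w0w R2 halt.
  by case: (w) BW B_gt1 => // BW0; have := expn_gt0 B W; lia.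
exists (loop_start + (T * loop_cost + (size (code_of loop_test) + 1) +
  (size (code_of footer) + (t' + 4)))), s3; split=> //.
  rewrite /loop_cost; nia.
rewrite (exec_add _ ex1) (exec_add _ ex2) (exec_add _ ex3) (exec_add _ ex4).
exact: ex5.
Qed.


End Printer.

(** * Input bits and vertex numbers as expressions *)

Section OVInput.
Set Implicit Arguments.
Unset Strict Implicit.

Lemma nth_flatten_uniform (T : Type) (x0 : T) d (ss : seq (seq T)) i k :
  all (fun s => size s == d) ss -> k < d ->
  nth x0 (flatten ss) (i * d + k) = nth x0 (nth [::] ss i) k.
Proof.
move=> + kd; elim: ss i => [|s ss IH] i /=; first by rewrite !nth_nil.
case/andP => /eqP sd ssd; rewrite nth_cat sd; case: i => [|i]; first by rewrite kd.
by rewrite ifF ?mulSn -?addnA ?addKn ?IH //; lia.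
Qed.

Lemma size_flatten_uniform (T : Type) d (ss : seq (seq T)) :
  all (fun s => size s == d) ss -> size (flatten ss) = size ss * d.
Proof.
by elim: ss => //= s ss IH /andP[/eqP sd /IH]; rewrite size_cat sd mulSn => ->.
Qed.

Variables (n d : nat) (L R : n.-tuple (d.-tuple bool)).

Lemma ov_vectors_uniform : all (fun s => size s == d) (map val (L ++ R)).
Proof. by apply/allP => s /mapP[y _ ->]; rewrite size_tuple. Qed.

Lemma size_ov_input : size (ov_input L R) = 2 + 2 * (n * d).
Proof.
rewrite /= size_map (size_flatten_uniform ov_vectors_uniform) size_map size_cat.
by rewrite !size_tuple; lia.
Qed.

(** Read from the input words, as the program does; the vectors of [R] follow those of [L], which
    matches the numbering of the centres. *)
Definition ov_bit (c k : nat) : bool := nth 0 (ov_input L R) (2 + (c * d + k)) != 0.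

Lemma ov_bitE (i : 'I_n) (k : 'I_d) :
  (ov_bit i k = tnth (tnth L i) k) * (ov_bit (n + i) k = tnth (tnth R i) k).
Proof.
have nthE c (x : d.-tuple bool) : c < n + n -> nth [::] (map val (L ++ R)) c = x ->
    ov_bit c k = tnth x k.
  move=> c_lt E; rewrite /ov_bit /= (nth_map false); last first.
    rewrite (size_flatten_uniform ov_vectors_uniform) size_map size_cat !size_tuple.
    by have := ltn_ord k; nia.
  rewrite nth_flatten_uniform ?E ?ltn_ord //; last exact: ov_vectors_uniform.
  by rewrite (tnth_nth false); case: nth.
split; apply: nthE; rewrite ?ltn_add2l ?ltn_addr //.
  rewrite (nth_map [tuple of nseq d false]) ?nth_cat ?size_cat ?size_tuple ?ltn_ord
    //; last first.
    by rewrite ltn_addr.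
  by rewrite (tnth_nth [tuple of nseq d false]).
rewrite (nth_map [tuple of nseq d false]) ?nth_cat ?size_cat ?size_tuple ?ltn_add2l
  //.
by rewrite ltnNge leq_addr /= addKn (tnth_nth [tuple of nseq d false]).
Qed.

Lemma has_orthogonal_pairP : reflect
  (exists i j, [/\ i < n, n <= j < 2 * n & forall k, k < d ->
    ~~ (ov_bit i k && ov_bit j k)])
  (has_orthogonal_pair L R).
Proof.
apply: (iffP existsP) =>
  [[i /existsP[j /forallP orth]]|[i [j [i_lt /andP[nj jn] orth]]]].
  exists i, (n + j); split=> //; first by have := ltn_ord j; lia.
  move=> k kd; have := orth (Ordinal kd).
  by rewrite -!(ov_bitE _ (Ordinal kd)) /= !eqbF_neg negb_and.
have j_lt : j - n < n by lia.
exists (Ordinal i_lt); apply/existsP; exists (Ordinal j_lt); apply/forallP => k.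
have := orth k (ltn_ord k); rewrite -{1}(subnKC nj).
have [/= -> _] := ov_bitE (Ordinal i_lt) k;
  have [/= _ ->] := ov_bitE (Ordinal j_lt) k.
by rewrite negb_and !eqbF_neg.
Qed.

End OVInput.

(** * Edge ends, edge conditions and loop bounds as expressions *)

Section Expressions.
Set Implicit Arguments.
Unset Strict Implicit.

Variables (r0 a b q : nat).

Local Notation "x +! y" := (Bin Add x y) (at level 50, left associativity).
Local Notation "x *! y" := (Bin Mul x y) (at level 40, left associativity).
Local Notation "x /! y" := (Bin Div x y) (at level 40, left associativity).
Local Notation "x %! y" := (Bin Mod x y) (at level 40, left associativity).
Local Notation "x -! y" := (Bin Defs.Sub x y) (at level 50, left associativity).

Let en : expr := Reg (r0 + 0).
Let ed : expr := Reg (r0 + 1).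
Let et : expr := Reg (r0 + 2).

(** Truncated subtraction makes this the indicator of [x <= y]. *)
Definition le_expr (x y : expr) : expr := Cst 1 -! (x -! y).
Definition lt_expr (x y : expr) : expr := le_expr (x +! Cst 1) y.

Definition narms_expr : expr := (Cst 2 *! en +! Cst 2) *! (ed +! Cst 2).

Definition arm_expr (c k : expr) (s : nat) : expr :=
  if s is s'.+1 then
    (Cst 2 *! en +! Cst 2) +! ((c *! (ed +! Cst 2) +! k) *! Cst a +! Cst s')
  else c.

Definition middle_expr (x : expr) : expr :=
  (Cst 2 *! en +! Cst 2) +! (narms_expr *! Cst a +! x).

Definition Cp_expr (k s : expr) : expr := middle_expr (k *! Cst (q + 1) +! s).

Definition Yp_expr (s : nat) : expr := middle_expr (ed *! Cst (q + 1) +! Cst s).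

Definition apex_expr (i : expr) : expr := arm_expr (Cst 2 *! en +! i) (ed +! Cst 1) a.

Definition spine_expr (s : nat) : expr :=
  if s == 0 then apex_expr (Cst 0)
  else if s == a + b + q then apex_expr (Cst 1) else Yp_expr s.-1.

Definition order_expr : expr :=
  (Cst 2 *! en +! Cst 1) +!
  (narms_expr *! Cst a +! (ed *! Cst (q + 1) +! Cst (a + b + q).-1)) +! Cst 1.

Definition ends_expr (j : nat * nat) : expr * expr :=
  let s := j.2 in
  match j.1 with
  | 0 => (arm_expr (et /! (ed +! Cst 2)) (et %! (ed +! Cst 2)) s,
          arm_expr (et /! (ed +! Cst 2)) (et %! (ed +! Cst 2)) s.+1)
  | 1 => (arm_expr (et /! ed) (et %! ed) b.-1,
          Cp_expr (et %! ed) (le_expr (en *! ed) et *! Cst q))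
  | 2 => (arm_expr et ed b.-1, apex_expr (le_expr en et))
  | 3 => (arm_expr (Cst 2 *! en +! le_expr ed et) (et %! ed) b.-1,
          Cp_expr (et %! ed) (le_expr ed et *! Cst q))
  | 4 => (Cp_expr et (Cst s), Cp_expr et (Cst s.+1))
  | _ => if (0 < s) && (s.+1 == a + b + q) then (spine_expr s.+1, spine_expr s)
         else (spine_expr s, spine_expr s.+1)
  end.

(** For kind 1, round [t = c * d + k] reads bit [k] of vector [c] at address [2 + t]; past the last
    bit the comparison multiplies the fetched value by 0. *)
Definition active_expr (j : nat * nat) : expr :=
  match j.1 with
  | 0 => Cst 1
  | 1 => lt_expr et (Cst 2 *! en *! ed) *! Fetch (Cst 2 +! et)
  | 2 => lt_expr et (Cst 2 *! en)
  | 3 => lt_expr et (Cst 2 *! ed)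
  | 4 => lt_expr et ed
  | _ => lt_expr et (Cst 1)
  end.

Definition fine (e : expr) : bool := regs_lt (r0 + 6) e && arith e.

Lemma fine_arm c k s : fine c -> fine k -> fine (arm_expr c k s).
Proof.
rewrite /fine => /andP[c1 c2] /andP[k1 k2]; case: s => [|s] /=; first by rewrite c1.
by rewrite !ltn_add2l c1 c2 k1 k2.
Qed.

Lemma fine_spine s : fine (spine_expr s).
Proof.
rewrite /spine_expr /apex_expr; do 2?case: ifP => _; try apply: fine_arm;
  by rewrite /fine /= ?ltn_add2l.
Qed.

Lemma fine_ends j : fine (ends_expr j).1 && fine (ends_expr j).2.
Proof.
have [fn fd ft] : [/\ fine en, fine ed & fine et].
  by rewrite /fine /= !ltn_add2l.
case: j => [[|[|[|[|[|g]]]]] s]; rewrite /ends_expr [(_, _).1]/= [(_, _).2]/=;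
  try by rewrite ?fine_arm // /fine /= ?ltn_add2l.
by case: ifP => _; rewrite !fine_spine.
Qed.

Lemma fine_active j : fine (active_expr j).
Proof. by case: j => [[|[|[|[|[|g]]]]] s]; rewrite /fine /= ?ltn_add2l. Qed.

Variables (n d t : nat) (inp : seq nat) (st : (nat -> nat) * (nat -> nat)).
Hypothesis ag : agree r0 inp n d t st.
Hypothesis size_inp : size inp = 2 + 2 * (n * d).

Let bit (c k : nat) : bool := nth 0 inp (2 + (c * d + k)) != 0.
Hypothesis inp_bit : forall x, nth 0 inp (2 + x) <= 1.
Local Notation ev e := (eval st.1 st.2 e).

Lemma eval_le_expr x y : ev (le_expr x y) = (ev x <= ev y).
Proof. by rewrite /=; lia. Qed.

Lemma eval_lt_expr x y : ev (lt_expr x y) = (ev x < ev y).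
Proof. by rewrite eval_le_expr /= addn1. Qed.

Lemma eval_order : ev order_expr = (order_pred n d a b q).+1.
Proof. by case: ag => /= -> -> _ _; rewrite addn1. Qed.

Lemma eval_narms : ev narms_expr = narms n d.
Proof. by case: ag => /= -> -> _ _. Qed.

Lemma eval_arm c k s : ev (arm_expr c k s) = num n d a q (arm (ev c) (ev k) s).
Proof. by rewrite num_arm; case: s => //= s; case: ag => -> -> _ _. Qed.

Lemma eval_Cp k s : ev (Cp_expr k s) = num n d a q (Cp (ev k) (ev s)).
Proof. by rewrite /=; case: ag => -> -> _ _. Qed.

Lemma eval_spine s : ev (spine_expr s) = num n d a q (spine n d a b q s).
Proof.
have [nE dE _ _] := ag.
rewrite /spine_expr /spine /apex_expr /apex; case: ifP => _.
  by rewrite eval_arm /= nE dE [d + 1]addn1.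
case: ifP => _; first by rewrite eval_arm /= nE dE [d + 1]addn1.
by rewrite /= nE dE.
Qed.

Lemma eval_ends j : (ev (ends_expr j).1 = num n d a q (ends n d a b q j t).1) *
  (ev (ends_expr j).2 = num n d a q (ends n d a b q j t).2).
Proof.
have [nE dE tE _] := ag.
have le1 x y : 1 - (x - y) = (x <= y) by lia.
have cendE (i : bool) : i * q = cend q i by case: i; rewrite ?mul1n ?mul0n.
case: j => [[|[|[|[|[|g]]]]] s]; rewrite /ends_expr /ends.
- by rewrite !eval_arm /= dE tE.
- by rewrite !eval_arm !eval_Cp /= nE dE tE le1 cendE.
- by rewrite /apex_expr !eval_arm /= dE tE nE le1 [d + 1]addn1.
- by rewrite !eval_arm !eval_Cp /= nE dE tE le1 cendE.
- by rewrite !eval_Cp /= tE.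
- by case: ifP => _; rewrite !eval_spine.
Qed.

Lemma eval_active j : ev (active_expr j) = active n d bit j t.
Proof.
have [nE dE tE mE] := ag.
case: j => [[|[|[|[|[|g]]]]] s]; rewrite /active_expr /active;
  try by rewrite eval_lt_expr /= ?nE ?dE tE.
  by [].
have evM x y : ev (x *! y) = ev x * ev y by [].
rewrite evM eval_lt_expr /= nE dE tE.
case: ltnP => t_lt //=; rewrite mul1n mE ?size_inp; last by lia.
rewrite /bit -divn_eq; have := inp_bit t.
by case: nth => [|[|]].
Qed.

End Expressions.

(** * The reduction *)

Section Reduction.
Set Implicit Arguments.
Unset Strict Implicit.

Variables (l q : nat).
Hypothesis l_gt0 : 0 < l.
Let a := l./2.
Let b := uphalf l.

Lemma half_facts : [/\ a + b = l, 0 < b, a <= b & b <= a.+1].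
Proof. by rewrite /a /b uphalf_half; split; have := odd_double_half l; lia. Qed.

Lemma gadget_diameter n d (L R : n.-tuple (d.-tuple bool)) : 0 < n ->
  has_diameter (gadget (n := n) (d := d) (a := a) (b := b) (q := q) (ov_bit L R))
    ((if has_orthogonal_pair L R then 3 else 2) * l + q).
Proof.
have [<- b_gt0 ab ba] := half_facts; move=> n_gt0.
case: has_orthogonal_pairP => [[i [j [i_lt j_lt orth]]]|no].
  exact: (gadget_diameter_far q n_gt0 b_gt0 ab ba i_lt j_lt orth).
apply: gadget_diameter_near => // i j i_lt j_lt.
case: (boolP [exists k : 'I_d, ov_bit L R i k && ov_bit L R j k]) =>
  [/existsP[k kE]|/existsP nE].
  by exists k.
case: no; exists i, j; split=> // k kd; apply/negP => bits.
by apply: nE; exists (Ordinal kd).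
Qed.

(** A fixed list of statements has a maximal weight, which is independent of the instance and enters
    only the word size. *)
Lemma exists_light r cs : all (wf_stmt r arith) cs ->
  exists W, all (wf_stmt r (light W)) cs.
Proof.
have mono W W' c : W <= W' -> wf_stmt r (light W) c -> wf_stmt r (light W') c.
  have lm e : W <= W' -> light W e -> light W' e.
    by rewrite /light => WW /andP[-> /leq_trans->].
  by move=> WW; case: c => [x e|ea ev] /=;
    [case/and3P => -> -> /(lm _ WW) -> | case/and4P =>
      -> -> /(lm _ WW) -> /(lm _ WW) ->].
elim: cs => [|c cs IH] /=; first by exists 0.
case/andP => wc /IH[W wcs].
have [W' wc'] : exists W', wf_stmt r (light W') c.
  case: c wc => [x e|ea ev] /=.
    by case/and3P => xr er ae; exists (weight e); rewrite /light xr er ae /=.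
  case/and4P => ar vr aa av; exists (maxn (weight ea) (weight ev)).
  by rewrite /light ar vr aa av leq_maxl leq_maxr.
exists (maxn W' W); rewrite (mono W') ?leq_maxl //=.
by apply: sub_all wcs => c'; apply: mono; apply: leq_maxr.
Qed.

Definition reduction_program (r0 : nat) (P : program) : program :=
  print_and_run r0 (entries a b q) (active_expr r0)
    (fun j => (ends_expr r0 a b q j).1) (fun j => (ends_expr r0 a b q j).2)
    (order_expr r0 a b q) (narms_expr r0) P.

Lemma reduction_wf r0 : exists W, all (wf_stmt (r0 + 6) (light W))
  (header r0 (order_expr r0 a b q) ++ loop_test r0 (narms_expr r0) ++
   loop_body r0 (entries a b q) (active_expr r0)
    (fun j => (ends_expr r0 a b q j).1) (fun j => (ends_expr r0 a b q j).2) ++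
   footer r0).
Proof.
apply: exists_light; rewrite !all_cat; apply/and4P; split.
- by rewrite /= !ltn_add2l.
- by rewrite /= !ltn_add2l.
- apply/andP; split; last by rewrite /= !ltn_add2l.
  elim: (entries a b q) => // j js IH.
  have /andP[/andP[u1 u2] /andP[v1 v2]] := fine_ends r0 a b q j.
  have /andP[c1 c2] := fine_active r0 j.
  by rewrite /= IH !ltn_add2l u1 u2 v1 v2 c1 c2.
- by rewrite /= !ltn_add2l.
Qed.

Lemma edges_printed n d bit : 0 < n ->
  out (entries a b q) (active n d bit)
    (fun j t => vx n d a b q (ends n d a b q j t).1 : nat)
    (fun j t => vx n d a b q (ends n d a b q j t).2 : nat) (narms n d) =
  [seq (val p.1, val p.2) | p <- gadget_edges n d a b q bit].
Proof.
move=> n_gt0; rewrite /out /gadget_edges map_flatten -map_comp; congr flatten.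
by apply: eq_map => t; rewrite /= /out_row -map_comp.
Qed.

Lemma graph_inputE N (s : seq ('I_N * 'I_N)) : graph_input s =
  [:: N, size [seq (val p.1, val p.2) | p <- s] &
    flat [seq (val p.1, val p.2) | p <- s]].
Proof. by rewrite /graph_input size_map /flat -map_comp. Qed.

(** * Word lengths and sizes *)

Definition magnitude (inp : seq nat) : nat := 2 + size inp + \max_(x <- inp) x.

Lemma mem_le_max (s : seq nat) x : x \in s -> x <= \max_(y <- s) y.
Proof. by move=> xs; apply: (@leq_bigmax_seq _ _ xpredT id). Qed.

Lemma nth_le_magnitude inp x : nth 0 inp x <= magnitude inp.
Proof.
rewrite /magnitude; case: (ltnP x (size inp)) => x_lt; last by rewrite nth_default.
apply: leq_trans (leq_addl _ _); exact: mem_le_max (mem_nth 0 x_lt).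
Qed.

(** Numbers up to a constant times a square need only a constant factor more bits. *)
Lemma scaled_square_le c x : 1 < x -> c * x ^ 2 <= 2 ^ ((c + 2) * up_log 2 x).
Proof.
move=> x1; have u1 : 0 < up_log 2 x by rewrite up_log_gt0.
apply: leq_trans (leq_mul (ltnW (ltn_expl c (ltnSn 1))) (leqnn _)) _.
rewrite mulnDl expnD; apply: leq_mul.
  by rewrite leq_exp2l // leq_pmulr.
by rewrite mulnC expnM leq_exp2r // up_logP.
Qed.

Lemma flat_le s B : {in s, forall p, p.1 <= B /\ p.2 <= B} ->
  {in flat s, forall x, x <= B}.
Proof.
move=> H x /flattenP[y /mapP[p ps ->]]; rewrite !inE.
by have [] := H p ps; do 2?move=> ?; case/orP => /eqP->.
Qed.

(** Generous enough that [size_factor] times the squared magnitude of the instance bounds vertex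
    numbers, addresses and the magnitude of the graph input. *)
Definition size_factor : nat := 6 * size (entries a b q) + 2 * a + 2 * q + l + 10.

Lemma narms_le n d X : n + 2 <= X -> d + 2 <= X -> narms n d <= 2 * X ^ 2.
Proof. by rewrite /narms => nX dX; rewrite expnS expn1; nia. Qed.

Lemma order_le n d X : n + 2 <= X -> d + 2 <= X ->
  (order_pred n d a b q).+1 <= (2 * a + 2 * q + l + 4) * X ^ 2.
Proof.
move=> nX dX; have := narms_le nX dX; have [<- _ _ _] := half_facts.
rewrite /order_pred => ar; have X2 : X * 2 <= X ^ 2 by rewrite expnS expn1; nia.
have : narms n d * a <= 2 * X ^ 2 * a by rewrite leq_mul2r ar orbT.
have : d * (q + 1) <= X ^ 2 * (q + 1) by rewrite leq_mul2r; apply/orP; right; lia.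
have : a + b <= X ^ 2 * (a + b) by rewrite leq_pmull //; lia.
have : q <= X ^ 2 * q by rewrite leq_pmull //; lia.
lia.
Qed.

(** [Q], [k'] and [A] are chosen before the instance, so they depend on [P], [k], l and q alone. *)
Lemma reduction_outputs (P : program) (k : nat) : exists (Q : program) (k' A : nat),
  forall n d (L R : n.-tuple (d.-tuple bool)), 0 < n ->
  let s := gadget_edges n d a b q (ov_bit L R) in
  size s <= A * (n * (d + 2)) /\
  forall t ans, outputs P k (graph_input s) t ans ->
  exists2 t', outputs Q k' (ov_input L R) t' (~~ ans) &
    t' <= A * (n * (d + 2)) + 2 * t.
Proof.
have [r0 [r0_gt0 P_regs]] := instr_regs_bound P.
have [W wf] := reduction_wf r0.
have [abl b_gt0 ab ba] := half_facts.
pose J := entries a b q; pose c := size_factor.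
pose ce := active_expr r0; pose ue j := (ends_expr r0 a b q j).1.
pose ve j := (ends_expr r0 a b q j).2; pose eN := order_expr r0 a b q.
pose eT := narms_expr r0.
pose Q := reduction_program r0 P.
(* The summands serve the words of the simulated program, the values up to [B ^ W], and the shift by
   the input size. *)
exists Q, (k * (c + 2) + (c + 2) * W + 2).
pose cost := loop_cost r0 J ce ue ve eT.
pose fixed := loop_start r0 eN + cost + size (code_of r0 (footer r0)) + 4.
(* There are at most [4 * (n * (d + 2))] rounds, each with at most [size J] edges and at price
   [cost]; [fixed] is paid once. *)
exists (4 * size J + fixed + 4 * cost) => n d L R n_gt0 s.
have armsE : narms n d <= 4 * (n * (d + 2)) by rewrite /narms; nia.
have sizeE : size s <= narms n d * size J.
  have := size_out J (active n d (ov_bit L R))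
    (fun j t => vx n d a b q (ends n d a b q j t).1 : nat)
    (fun j t => vx n d a b q (ends n d a b q j t).2 : nat) (narms n d).
  by rewrite edges_printed // size_map.
split.
  apply: leq_trans sizeE _.
  have := leq_mul armsE (leqnn (size J)); nia.
move=> t ans [st [ex halt ansE]].
pose inp := ov_input L R; pose X := magnitude inp.
have inp_size : size inp = 2 + 2 * (n * d) := size_ov_input L R.
have nX : n + 2 <= X.
  have : n <= \max_(x <- inp) x by apply: mem_le_max; apply: mem_head.
  by rewrite /X /magnitude; lia.
have dX : d + 2 <= X.
  have d_in : d \in inp by rewrite /inp /ov_input !inE eqxx orbT.
  have : d <= \max_(x <- inp) x by apply: mem_le_max.
  by rewrite /X /magnitude; lia.
have X_gt1 : 1 < X by rewrite /X /magnitude; lia.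
have X2 : X <= X ^ 2 by rewrite -{1}(expn1 X) leq_exp2l.
have X2' : 4 <= X ^ 2 by rewrite (leq_exp2r 2 X (_ : 0 < 2)).
pose B := c * X ^ 2; pose u := up_log 2 X.
have ar := narms_le nX dX; have orderB := order_le nX dX.
have arJ : narms n d * size J <= 2 * X ^ 2 * size J by rewrite leq_mul2r ar orbT.
have cE : c = 6 * size J + 2 * a + 2 * q + l + 10 by [].
have le_B m : m <= (6 * size J + 2 * a + 2 * q + l + 10) * X ^ 2 -> m <= B.
  by rewrite -cE.
have N_le : (order_pred n d a b q).+1 <= B.
  by apply: le_B; apply: leq_trans orderB _; rewrite leq_mul2r; apply/orP; right; lia.
have vx_le v : (vx n d a b q v : nat) <= B.
  exact: leq_trans (ltnW (ltn_ord _)) N_le.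
have u_gt0 : 0 < u by rewrite up_log_gt0.
have XB : X <= B by apply: leq_trans X2 _; rewrite leq_pmull // cE; lia.
have Xu : X <= 2 ^ u := up_logP X (ltnSn 1).
set k' := k * (c + 2) + (c + 2) * W + 2.
have wE : word_size k' inp = k' * u by [].
have Bu : B <= 2 ^ ((c + 2) * u) by apply: scaled_square_le.
have BW : B ^ W < 2 ^ word_size k' inp.
  rewrite wE; apply: (@leq_ltn_trans (2 ^ ((c + 2) * u * W))); last first.
    by rewrite ltn_exp2l // mulnAC ltn_mul2r u_gt0 /k'; lia.
  by rewrite expnM; case: (W) => // W'; rewrite leq_exp2r.
have size_le : size inp + 2 + 2 * (narms n d * size J) <= B.
  apply: le_B; have : size inp <= X by rewrite /X /magnitude; lia.
  by move: arJ X2 X2'; lia.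
pose us j t := (vx n d a b q (ends n d a b q j t).1 : nat).
pose vs j t := (vx n d a b q (ends n d a b q j t).2 : nat).
have outE : out J (active n d (ov_bit L R)) us vs (narms n d) =
    [seq (val p.1, val p.2) | p <- s] by apply: edges_printed.
have w0w : 2 ^ word_size k (graph_input s) + size inp <= 2 ^ word_size k' inp.
  have g_le : magnitude (graph_input s) <= B.
    have [g_size g_max] : size (graph_input s) = 2 + 2 * size s /\
        \max_(x <- graph_input s) x <= (order_pred n d a b q).+1 + size s.
      rewrite graph_inputE /= size_flat size_map; split=> //.
      apply/bigmax_leqP_seq => x; rewrite !inE => /or3P[/eqP->|/eqP->|xs] _.
      - exact: leq_addr.
      - exact: leq_addl.
      - apply: leq_trans (leq_addr _ _); move: x xs;
          apply: flat_le => p /mapP[p' _ ->] /=.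
        by split; apply: ltnW.
    rewrite {1}/magnitude g_size; apply: le_B.
    by move: orderB sizeE arJ g_max X2'; lia.
  rewrite wE; have g_u : word_size k (graph_input s) <= k * ((c + 2) * u).
    rewrite /word_size leq_mul2l; apply/orP; right; apply: up_log_min => //.
    exact: leq_trans g_le Bu.
  have inp_u : size inp <= 2 ^ u by apply: leq_trans Xu; rewrite /X /magnitude; lia.
  (* Both summands are at most the same power of 2, so one more bit suffices for their sum. *)
  apply: (@leq_trans (2 ^ (k * ((c + 2) * u) + u) + 2 ^ (k * ((c + 2) * u) + u))).
    apply: leq_add; first by rewrite leq_exp2l // (leq_trans g_u) ?leq_addr.
    by apply: leq_trans inp_u _; rewrite leq_exp2l // leq_addl.
  rewrite addnn -mul2n -expnS leq_exp2l // /k' mulnA.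
  by move: (k * (c + 2)) ((c + 2) * W) => y z; rewrite !mulnDl; move: u_gt0; lia.
have inp_bit x : nth 0 inp (2 + x) <= 1.
  rewrite /inp /=; case: (ltnP x (size (flatten (map val (L ++ R))))) => x_lt.
    by rewrite (nth_map false) //; case: nth.
  by rewrite nth_default // size_map.
rewrite graph_inputE -outE in ex w0w.
have arB : narms n d <= B by apply: leq_trans ar _; rewrite leq_mul2r cE;
  apply/orP; right; lia.
have eNP st' : agree r0 inp n d 0 st' ->
  eval st'.1 st'.2 eN = (order_pred n d a b q).+1.
  exact: eval_order.
have eTP t0 st' : agree r0 inp n d t0 st' -> eval st'.1 st'.2 eT = narms n d.
  exact: eval_narms.
have ceP j t0 st' : j \in J -> t0 < narms n d -> agree r0 inp n d t0 st' ->
    eval st'.1 st'.2 (ce j) = active n d (ov_bit L R) j t0.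
  by move=> _ _ ag; apply: (eval_active ag).
have endsP j t0 st' : j \in J -> t0 < narms n d -> agree r0 inp n d t0 st' ->
    active n d (ov_bit L R) j t0 ->
    (eval st'.1 st'.2 (ue j) = us j t0) * (eval st'.1 st'.2 (ve j) = vs j t0).
  move=> jJ t_lt ag act;
    have /andP[V1 V2] := valid_ends n_gt0 b_gt0 ab ba jJ t_lt act.
  by rewrite /ue /ve !(eval_ends _ _ _ ag) // /us /vs /= (vxK n_gt0 b_gt0 ab ba V1)
    (vxK n_gt0 b_gt0 ab ba V2).
have [t' [s' [t'_le ex' halt' ans']]] := print_and_runP (erefl n : nth 0 inp 0 = n)
  (erefl d : nth 0 inp 1 = d) inp_size eNP eTP ceP
  (fun j t0 st' jJ t_lt ag act => (endsP j t0 st' jJ t_lt ag act).1)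
  (fun j t0 st' jJ t_lt ag act => (endsP j t0 st' jJ t_lt ag act).2)
  (leq_trans X_gt1 XB) BW (fun x => leq_trans (nth_le_magnitude inp x) XB) N_le
  arB (fun j t0 _ _ _ => vx_le _)
  (fun j t0 _ _ _ => vx_le _) size_le wf r0_gt0 P_regs w0w ex halt ansE.
exists t'; first by exists s'.
have fixedE : fixed = loop_start r0 eN + cost + size (code_of r0 (footer r0)) + 4
  by [].
rewrite -/cost in t'_le; clearbody fixed cost.
have nd : 0 < n * (d + 2) by rewrite muln_gt0 n_gt0 addn2.
have := leq_mul (leqnn cost) armsE; have := leq_mul (leqnn fixed) nd.
move: (n * (d + 2)) (size J) => M m; rewrite !mulnDl; lia.
Qed.

End Reduction.

(** * The running time and the hardness result *)

Import Order.TTheory GRing.Theory Num.Theory.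
Local Open Scope ring_scope.

(** For positive [m], lowering [delta] to at most 1 only raises the bound; the exponent is then
    positive, so the power is monotone in its base. The factor depending on [d] is at least 1,
    thanks to [A.+1], and its power is rounded up to a square. *)
Lemma powR_edges_le (R : realType) (delta : R) (A n d m : nat) :
  0 < delta -> (0 < n)%N -> (m <= A.+1 * (n * (d + 2)))%N ->
  m%:R `^ (2 - delta) <=
    n%:R `^ (2 - Num.min delta 1) * (A.+1%:R * (d%:R + 2)) ^+ 2 :> R.
Proof.
move=> delta_gt0 n_gt0 m_le; set delta' := Num.min delta 1.
have n_ge1 : 1 <= n%:R :> R by rewrite ler1n.
have delta'_le1 : delta' <= 1 by rewrite ge_min lexx orbT.
have e_ge1 : 1 <= 2 - delta' by lra.
have e_ge0 : 0 <= 2 - delta' := le_trans ler01 e_ge1.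
set c := A.+1%:R * (d%:R + 2) : R.
have c_ge1 : 1 <= c.
  rewrite /c -natrD -natrM ler1n muln_gt0 /=; lia.
have rhs_ge1 : 1 <= n%:R `^ (2 - delta') * c ^+ 2.
  rewrite -[leLHS]mulr1; apply: ler_pM; rewrite ?ler01 ?exprn_ege1 //.
  by have := ler_powR n_ge1 e_ge0; rewrite powRr0.
(* For [m] equal to 0 the left side is 0, or 1 if the exponent is 0 too. *)
case: (posnP m) => [->|m_gt0].
  apply: le_trans rhs_ge1; rewrite /powR eqxx; by case: (_ == 0).
apply: (@le_trans _ _ (m%:R `^ (2 - delta'))).
  by rewrite ler_powR ?ler1n // lerB // /delta' ge_min lexx.
apply: (@le_trans _ _ ((n%:R * c) `^ (2 - delta'))).
  apply: ge0_ler_powR => //; rewrite ?nnegrE ?ler0n //.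
    by rewrite mulr_ge0 // (le_trans ler01).
  by rewrite /c -natrD -!natrM ler_nat mulnCA.
rewrite powRM ?ler0n ?(le_trans ler01) // ler_wpM2l ?powR_ge0 //.
rewrite -powR_mulrn ?(le_trans ler01) // ler_powR //.
by rewrite gerBl le_min (ltW delta_gt0) ler01.
Qed.

Theorem corollary3p3 (R : realType) (l q : nat) (delta : R) :
  OVH R -> (1 <= l)%N -> 0 < delta ->
  ~ distinguishable_in_time (2 * l + q)%N (3 * l + q)%N
      (fun m : nat => m%:R `^ (2 - delta) / (l + q)%:R `^ (2 - delta)).
Proof.
move=> ovh l_gt0 delta_gt0 [P [k [C algo]]]; apply: ovh.
have [Q [k' [A red]]] := reduction_outputs q l_gt0 P k.
have [_ b_gt0 ab ba] := half_facts l_gt0.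
(* The absolute value is taken because [C] may be negative; the denominator is a constant of the
   problem. *)
pose D : R := `|C| / (l + q)%:R `^ (2 - delta).
(* The first summand of the polynomial pays for the linear preprocessing, the second for the
   simulated run, whose steps are doubled. *)
exists Q, k', (Num.min delta 1),
  (A%:R *: ('X + 2%:P) + (2 * D) *: (A.+1%:R *: ('X + 2%:P)) ^+ 2).
split=> [|n d L R' n_gt0]; first by rewrite lt_min delta_gt0 ltr01.
have [size_s run] := red n d L R' n_gt0;
  set s := gadget_edges _ _ _ _ _ _ in size_s run.
have s_lt : forall p, p \in s -> (p.1 < p.2)%N.
  by move=> p; apply: gadget_edges_lt.
have s_uniq : uniq s by apply: uniq_gadget_edges.
have diam := gadget_diameter q l_gt0 L R' n_gt0.
have [|t [ans [outP ansP t_le]]] := algo _ _ s (simple_graph_of s_lt)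
  (edge_list_graph_of s_lt s_uniq).
  by case: has_orthogonal_pair diam => ?; [right | left].
(* [ans] is true exactly for diameter 2l + q, that is, without an orthogonal pair; the diameters
   differ since l is positive. *)
have ansE : ~~ ans = has_orthogonal_pair L R'.
  case: ans ansP {outP} => /(has_diameter_inj diam); case: has_orthogonal_pair; lia.
have [t' outQ t'_le] := run t ans outP.
exists t'; split; first by rewrite -ansE.
set y := n%:R `^ (2 - Num.min delta 1).
have n_le_y : n%:R <= y.
  rewrite -[leLHS]powRr1 ?ler0n // ler_powR ?ler1n //.
  have : Num.min delta 1 <= 1 by rewrite ge_min lexx orbT.
  by lra.
have t_le' : t%:R <= D * (y * (A.+1%:R * (d%:R + 2)) ^+ 2).
  apply: le_trans t_le _; rewrite card_edges_graph_of //.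
  apply: (@le_trans _ _ (D * (size s)%:R `^ (2 - delta))).
    rewrite /D [_ / _]mulrC mulrA ler_wpM2r ?powR_ge0 // ler_wpM2r ?ler_norm //.
    by rewrite invr_ge0 powR_ge0.
  apply: ler_wpM2l; first by rewrite /D divr_ge0 ?powR_ge0.
  by apply: powR_edges_le => //; apply: leq_trans size_s _;
    rewrite leq_mul2r leqnSn orbT.
apply: (@le_trans _ _ (A * (n * (d + 2)) + 2 * t)%:R); first by rewrite ler_nat.
rewrite natrD !natrM natrD hornerD !hornerZ horner_exp hornerZ hornerD hornerX
  hornerC [leRHS]mulrDr.
apply: lerD; first by rewrite mulrCA ler_wpM2r // mulr_ge0 // -natrD ler0n.
set c := A.+1%:R * _ in t_le' *.
by rewrite (_ : y * _ = 2 * (D * (y * c ^+ 2))) ?ler_wpM2l //; ring.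
Qed.
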